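(* Let $p$ be a prime number, let $d$ and $e$ be arbitrary cardinal numbers, and let $\Upsilon\in\{0,1\}$. Then there exists a field $F$ containing a primitive $p$th root of unity $\xi_p$ and a cyclic field extension $K/F$ of degree $p$ with $d(K/F)=d$, $e(K/F)=e$ and $\Upsilon(K/F)=\Upsilon$ if and only if all of the following hold: (1) if $\Upsilon=0$, then $1\le d$; (2) if $p>2$, then $1\le e$; (3) if $p=2$ and $\Upsilon=1$, then $1\le e$.
   Context: For a field $F$ of characteristic not $p$ containing a primitive $p$th root of unity $\xi_p$ and a cyclic extension $K/F$ of degree $p$, with norm map $N=N_{K/F}:K^\times\to F^\times$, the arithmetic invariants are: $d(K/F)=\dim_{\mathbb{F}_p} F^\times/N(K^\times)$; $e(K/F)=\dim_{\mathbb{F}_p} N(K^\times)/F^{\times p}$; and $\Upsilon(K/F)=1$ if $\xi_p\in N(K^\times)$ and $\Upsilon(K/F)=0$ otherwise. Dimensions are cardinal numbers (possibly infinite). *)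

(* Defs.v *)
From HB Require Import structures.
From mathcomp Require Import all_boot all_order all_fingroup all_algebra.
From mathcomp Require Import all_solvable all_field.
From mathcomp Require Import generic_quotient ring_quotient.
From mathcomp Require Import boolp classical_sets functions cardinality.

Set Implicit Arguments.
Unset Strict Implicit.
Unset Printing Implicit Defensive.

Import GRing.Theory.

Local Open Scope ring_scope.

(* A cardinal number is represented by a type [I]: "dim V = |I|" means that V
   has a basis indexed by I. Finite subsets of I are given by injections from
   'I_n, which requires no structure on I. *)
Section Dimension.
Variables (k : fieldType) (V : lmodType k) (I : Type).

Definition lin_indep (b : I -> V) : Prop :=
  forall (n : nat) (s : 'I_n -> I) (c : 'I_n -> k), injective s ->
    \sum_(j < n) c j *: b (s j) = 0 -> forall j, c j = 0.

Definition spanning (b : I -> V) : Prop :=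
  forall v : V, exists (n : nat) (s : 'I_n -> I) (c : 'I_n -> k),
    v = \sum_(j < n) c j *: b (s j).

Definition has_dim : Prop := exists b : I -> V, lin_indep b /\ spanning b.

End Dimension.

(* An abelian group V killed by a prime p, as a vector space over 'F_p. *)
Definition FpMod (p : nat) (p_pr : prime p) (V : zmodType)
  (pV : forall v : V, v *+ p = 0) : Type := V.

Section FpModule.
Variables (p : nat) (p_pr : prime p) (V : zmodType).
Variable pV : forall v : V, v *+ p = 0.
Local Notation M := (FpMod p_pr pV).

HB.instance Definition _ := GRing.Zmodule.on M.

Definition Fp_scale (c : 'F_p) (v : M) : M := v *+ c.

Fact Fp_mulrn_mod n (v : M) : v *+ (n %% (Zp_trunc (pdiv p)).+2) = v *+ n.
Proof.
rewrite Fp_cast //.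
by rewrite [in RHS](divn_eq n p) mulrnDr mulnC mulrnA pV mul0rn add0r.
Qed.

Fact Fp_scaleA a b v : Fp_scale a (Fp_scale b v) = Fp_scale (a * b) v.
Proof. by rewrite /Fp_scale -mulrnA /= Fp_mulrn_mod mulnC. Qed.

Fact Fp_scale1 : left_id 1 Fp_scale.
Proof. by move=> v; rewrite /Fp_scale /= mulr1n. Qed.

Fact Fp_scaleDr : right_distributive Fp_scale +%R.
Proof. by move=> c u v; rewrite /Fp_scale mulrnDl. Qed.

Fact Fp_scaleDl v : {morph Fp_scale^~ v : a b / a + b}.
Proof.
by move=> a b; rewrite /Fp_scale /= Fp_mulrn_mod mulrnDr.
Qed.

HB.instance Definition _ := GRing.Zmodule_isLmodule.Build 'F_p M
  Fp_scaleA Fp_scale1 Fp_scaleDr Fp_scaleDl.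

End FpModule.

(* The multiplicative group of F. Since it is to be quotiented into vector
   spaces its zmodType structure is additive: 0, + and *+ on [units F] are
   1, * and ^+ in F. *)
Record units (F : fieldType) := Units { uval :> F; uval_neq0 : uval != 0 }.

HB.instance Definition _ (F : fieldType) := [isSub for @uval F].
HB.instance Definition _ (F : fieldType) := [Choice of units F by <:].

Section Units.
Variable F : fieldType.
Implicit Types x y z : units F.

Definition uone : units F := Units (oner_neq0 F).
Definition umul x y : units F :=
  Units (mulf_neq0 (uval_neq0 x) (uval_neq0 y)).
Definition uinv x : units F := Units (invr_neq0 (uval_neq0 x)).

Fact umulA : associative umul.
Proof. by move=> x y z; apply: val_inj; rewrite /= mulrA. Qed.

Fact umulC : commutative umul.
Proof. by move=> x y; apply: val_inj; rewrite /= mulrC. Qed.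

Fact umul1 : left_id uone umul.
Proof. by move=> x; apply: val_inj; rewrite /= mul1r. Qed.

Fact umulV : left_inverse uone uinv umul.
Proof. by move=> x; apply: val_inj; rewrite /= mulVf // uval_neq0. Qed.

HB.instance Definition _ := GRing.isZmodule.Build (units F)
  umulA umulC umul1 umulV.

Lemma uval0 : uval (0 : units F) = 1. Proof. by []. Qed.

Lemma uvalD x y : uval (x + y) = uval x * uval y. Proof. by []. Qed.

Lemma uvalN x : uval (- x) = (uval x)^-1. Proof. by []. Qed.

Lemma uvalMn x n : uval (x *+ n) = uval x ^+ n.
Proof. by elim: n => [|n IHn] //; rewrite mulrS exprS uvalD IHn. Qed.

End Units.

Definition cyclic_ext (p : nat) (F : fieldType) (K : splittingFieldType F) :
    Prop :=
  [/\ galois 1 {:K}, cyclic 'Gal({:K} / 1) & \dim {:K} = p].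

Section Norms.
Variables (F : fieldType) (K : splittingFieldType F).

(* N(K^x) as a subgroup of F^x; [x%:A] is the image of x : F in K. *)
Definition norms : {pred units F} := fun x =>
  `[< exists2 a : K, a != 0 & galNorm 1 {:K} a = (uval x)%:A >].

Fact norms_zmod_closed : zmod_closed norms.
Proof.
split=> [|x y /asboolP[a a0 Na] /asboolP[b b0 Nb]]; apply/asboolP.
  by exists 1; rewrite ?oner_neq0 // galNorm1 uval0 scale1r.
exists (a / b); first by rewrite mulf_neq0 // invr_eq0.
rewrite galNormM galNormV Na Nb uvalD uvalN.
by rewrite -!in_algE rmorphM fmorphV.
Qed.

HB.instance Definition _ := GRing.isZmodClosed.Build (units F) norms
  norms_zmod_closed.

Lemma norms_pth_power p (x : units F) : cyclic_ext p K -> x *+ p \in norms.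
Proof.
case=> galK _ dimK; apply/asboolP; exists (uval x)%:A.
  by rewrite -in_algE fmorph_eq0 uval_neq0.
have cardG : #|'Gal({:K} / 1)%g| = p.
  by rewrite -galois_dim // dimv1 divn1.
have -> : galNorm 1 {:K} (uval x)%:A = \prod_(s in 'Gal({:K} / 1)%g) (uval x)%:A.
  by apply: eq_bigr => s sG; rewrite (fixed_gal _ sG) ?sub1v ?rpredZ ?mem1v.
by rewrite prodr_const cardG uvalMn -!in_algE rmorphXn.
Qed.

Record norm_group := NormGroup { nval :> units F; nvalP : nval \in norms }.

HB.instance Definition _ := [isSub for nval].
HB.instance Definition _ := [Choice of norm_group by <:].
HB.instance Definition _ := [SubChoice_isSubZmodule of norm_group by <:].

(* F^(x p) as a subgroup of N(K^x); it is contained in N(K^x) by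
   [norms_pth_power]. *)
Definition pth_powers (p : nat) : {pred norm_group} := fun x =>
  `[< exists y : units F, nval x = y *+ p >].

Fact pth_powers_zmod_closed p : zmod_closed (pth_powers p).
Proof.
split=> [|x y /asboolP[u xu] /asboolP[v yv]]; apply/asboolP.
  by exists 0; rewrite mul0rn.
by exists (u - v); rewrite mulrnBl -xu -yv.
Qed.

HB.instance Definition _ p := GRing.isZmodClosed.Build norm_group (pth_powers p)
  (pth_powers_zmod_closed p).

Fact norm_classes_exp p (v : Quotient.quot norms) :
  cyclic_ext p K -> v *+ p = 0.
Proof.
move=> cK; rewrite -[v]reprK -raddfMn; apply/eqP.
rewrite -(raddf0 (\pi_(Quotient.quot norms))%qT) -Quotient.idealrBE subr0.
exact: norms_pth_power.
Qed.

Fact power_classes_exp p (v : Quotient.quot (pth_powers p)) : v *+ p = 0.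
Proof.
rewrite -[v]reprK -raddfMn; apply/eqP.
rewrite -(raddf0 (\pi_(Quotient.quot (pth_powers p)))%qT).
rewrite -Quotient.idealrBE subr0; apply/asboolP.
by exists (nval (repr v)); rewrite -[nval]/val raddfMn.
Qed.

(* The F_p-vector space F^x / N(K^x), of dimension d(K/F). *)
Definition d_space (p : nat) (p_pr : prime p) (cK : cyclic_ext p K) :
    lmodType 'F_p :=
  FpMod p_pr (fun v : Quotient.quot norms => norm_classes_exp v cK).

(* The F_p-vector space N(K^x) / F^(x p), of dimension e(K/F). *)
Definition e_space (p : nat) (p_pr : prime p) : lmodType 'F_p :=
  FpMod p_pr (@power_classes_exp p).

Definition Upsilon (xi : F) : nat :=
  `[< exists2 a : K, a != 0 & galNorm 1 {:K} a = xi%:A >].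

End Norms.

(* Main.v *)
Require Import Defs.
From HB Require Import structures.
From mathcomp Require Import all_boot all_order all_fingroup all_algebra.
From mathcomp Require Import all_solvable all_field.
From mathcomp Require Import generic_quotient ring_quotient.
From mathcomp Require Import boolp classical_sets functions cardinality filter.
From mathcomp Require Import ring zify.

(** Necessity: by Hilbert 90, K = F(z) with a = z^p in F, and -a = N(-z) is a norm.
If xi is not a norm, then 1 <= d.  If -1 is a norm (which is automatic for odd p,
and is the condition Upsilon = 1 for p = 2), then a is a norm which is not a
p-th power, so 1 <= e.

Sufficiency: let W be an algebraically closed field with a valuation, L a subfield
of units with L^x = <xi> L^(x p), and (x_j) elements of W no nontrivial monomial
of which is a unit.  Let H be a subfield of W that is maximal for the
property that all leading terms of its elements lie in L^x <x_j>.  By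
Kaplansky's argument the 1-units of H are p-th powers in H, so that
H^x/H^(x p) is generated by xi and the x_j, and comparing leading terms shows
that the norms from H(x_0^(1/p)) are the elements of <-x_0> H^(x p).  This is the
case e = 1, with d as large as we please.  To enlarge e, choose c_i in L with
distinct p-th powers: the elements c_i^p - x_0 are norms from L(x_j)(x_0^(1/p)) and are
independent modulo p-th powers in L(x_j), being distinct primes in x_0.  A subfield F of
H maximal for the property that they stay independent modulo F^(x p)
satisfies: an element of F which is a p-th power in H is a p-th power in F up to
the c_i^p - x_0.  Hence F has the same d as H, and e is the number of the c_i.
For p = 2 and e = 0 one takes L real closed and H(sqrt(-1))/H instead.

The field W is an ultrapower of the field of algebraic numbers. *)

Set Implicit Arguments.
Unset Strict Implicit.
Unset Printing Implicit Defensive.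
Import Order.TTheory GRing.Theory Num.Theory.
Local Open Scope ring_scope.

(** * Subfields of a field *)

(** Besides the x_j with j <> 0, only xi can contribute to F^x/N(K^x), and it does so exactly when
    it is not a p-th power in L. So L decides Upsilon: it is built from all algebraic numbers when
    Upsilon = 1, and from a field whose power classes are generated by a non-power xi when Upsilon =
    0. In H all the norms c_i^p - x_0 fall into the single group <-x_0> H^(x p); shrinking H to F
    separates them again and creates no other class, so e grows while d stays. The obstacle is e =
    0: in the ramified construction -x_0 is a norm and not a p-th power. Hence the separate
    construction for p = 2, with an extension that does not enlarge the group of values. All fields
    are subfields of one W, and L is a subfield rather than a quotient. Leading terms are thus
    elements of W, and each field can be found by Zorn's lemma. The ultrapower supplies as many
    independent values and as many elements of L as desired, while L keeps the required properties
    of its components. *)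

Section SubfieldType.
Variables (W : fieldType) (F : divringClosed W).

Record sfield := SField { sfval :> W; sfvalP : sfval \in F }.

HB.instance Definition _ := [isSub for sfval].
HB.instance Definition _ := [Choice of sfield by <:].
HB.instance Definition _ := [SubChoice_isSubIntegralDomain of sfield by <:].
HB.instance Definition _ := [SubIntegralDomain_isSubField of sfield by <:].

Lemma polyOver_sfield (f : {poly W}) :
  f \is a polyOver F -> exists g : {poly sfield}, f = map_poly (val : sfield -> W) g.
Proof.
move=> /polyOverP Ff; exists (\poly_(i < size f) SField (Ff i)).
apply/polyP => i; rewrite coef_map coef_poly /=.
by case: ltnP => //= h; rewrite nth_default.
Qed.

Lemma modp_subfield (f g : {poly W}) :
  f \is a polyOver F -> g \is a polyOver F -> f %% g \is a polyOver F.
Proof.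
move=> /polyOver_sfield[f' ->] /polyOver_sfield[g' ->].
by rewrite -map_modp; apply/polyOverP => i; rewrite coef_map /= sfvalP.
Qed.

End SubfieldType.

Section Subfields.
Variable W : fieldType.
Implicit Types (F G : divringClosed W) (x y r : W).

Lemma mk_subfield (P : W -> Prop) :
  P 1 -> (forall x y, P x -> P y -> P (x - y)) ->
  (forall x y, P x -> P y -> P (x / y)) ->
  exists F, forall x, x \in F <-> P x.
Proof.
move=> P1 PB PV; pose Pb := [pred x | `[< P x >]].
have cP : divring_closed Pb.
  split; first exact/asboolP.
    by move=> x y /asboolP Px /asboolP Py; apply/asboolP; apply: PB.
  by move=> x y /asboolP Px /asboolP Py; apply/asboolP; apply: PV.
pose F : divringClosed W := HB.pack (Pb : pred W) (GRing.isDivringClosed.Build W Pb cP).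
by exists F => x; split=> /asboolP.
Qed.

(** The field F(r), described by fractions so that algebraic and transcendental r are treated
    alike. *)
Definition adjoins F r x := exists f g,
  [/\ f \is a polyOver F, g \is a polyOver F, g.[r] != 0 & x = f.[r] / g.[r]].

Lemma adjoin_ex F r : exists G, forall x, x \in G <-> adjoins F r x.
Proof.
apply: mk_subfield.
- by exists 1, 1; split; rewrite ?rpred1 // hornerC ?oner_eq0 // divr1.
- move=> _ _ [f [g [Ff Fg g0 ->]]] [f' [g' [Ff' Fg' g0' ->]]].
  exists (f * g' - f' * g), (g * g'); split.
  + by rewrite rpredB ?rpredM.
  + by rewrite rpredM.
  + by rewrite hornerM mulf_neq0.
  + by rewrite !hornerE -mulNr addf_div // mulNr.
- move=> _ _ [f [g [Ff Fg g0 ->]]] [f' [g' [Ff' Fg' g0' ->]]].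
  have [f0|f0] := eqVneq f'.[r] 0.
    exists 0, 1; split; rewrite ?rpred0 ?rpred1 ?hornerE ?oner_eq0 //.
    by rewrite f0 ?(mul0r, invr0, mulr0).
  exists (f * g'), (g * f'); split; rewrite ?rpredM ?hornerM ?mulf_neq0 //.
  by rewrite invf_div mulf_div.
Qed.

Lemma adjoins_base F r x : x \in F -> adjoins F r x.
Proof.
by move=> Fx; exists x%:P, 1; split;
  rewrite ?polyOverC ?rpred1 ?hornerC ?oner_eq0 ?divr1.
Qed.

Lemma adjoins_gen F r : adjoins F r r.
Proof.
by exists 'X, 1; split;
  rewrite ?polyOverX ?rpred1 ?hornerC ?hornerX ?oner_eq0 ?divr1.
Qed.

Lemma adjoins_min F G r x : {subset F <= G} -> r \in G -> adjoins F r x -> x \in G.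
Proof.
move=> sFG Gr [f [g [/(polyOverS sFG) Gf /(polyOverS sFG) Gg _ ->]]].
by rewrite rpred_div ?rpred_horner.
Qed.

(* Unlike divringClosed W, this type of subfields lives in the universe of W, as
   Zorn's lemma requires. *)
Definition subfield_pack (P : {P : W -> bool | divring_closed P}) : divringClosed W :=
  HB.pack (sval P) (GRing.isDivringClosed.Build W (sval P) (svalP P)).

Lemma subfield_Zorn (Q : divringClosed W -> Prop) F0 : Q F0 ->
  (forall C : divringClosed W -> Prop,
    (exists F, C F) -> (forall F, C F -> Q F) ->
    (forall F G, C F -> C G -> {subset F <= G} \/ {subset G <= F}) ->
    forall G, (forall x, x \in G <-> exists2 F, C F & x \in F) -> Q G) ->
  exists F, [/\ {subset F0 <= F}, Q F &
    forall G, {subset F <= G} -> Q G -> {subset G <= F}].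
Proof.
move=> Q0 Qch.
(* Invariance of [Q] under extensional equality is the chain hypothesis for the chain with the
   single member F. *)
have Qext F G : F =i G -> Q F -> Q G.
  move=> FG QF; apply: (Qch (fun F' => F' = F)); first by exists F.
  - by move=> _ ->.
  - by move=> _ _ -> ->; left.
  by move=> x; rewrite -FG; split=> [|[_ ->]//]; exists F.
have packE F : exists P, subfield_pack P =i F.
  by exists (exist _ (fun x => x \in F) (GRing.divringClosedP F)).
pose T := {P | Q (subfield_pack P) /\ {subset F0 <= subfield_pack P}}.
pose fld (t : T) := subfield_pack (sval t).
have mkT F : Q F -> {subset F0 <= F} -> exists t, fld t =i F.
  move=> QF F0F; have [P PF] := packE F.
  have h : Q (subfield_pack P) /\ {subset F0 <= subfield_pack P}.
    split; first by apply: Qext QF => x; rewrite PF.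
    by move=> x /F0F; rewrite PF.
  by exists (exist _ P h).
pose R (s t : T) := `[< {subset fld s <= fld t} >].
have [t00 t00E] := mkT F0 Q0 (fun x h => h).
have [|||t maxt] := @ZL_preorder T t00 R.
- by move=> t; apply/asboolP.
- by move=> r s t /asboolP rs /asboolP st; apply/asboolP => x /rs /st.
- move=> A totA; have [[t0 At0]|nA] := pselect (exists t, A t); last first.
    by exists t00 => s As; case: nA; exists s.
  pose C F := exists2 t : T, A t & F = fld t.
  have Cch F G : C F -> C G -> {subset F <= G} \/ {subset G <= F}.
    move=> [s As ->] [t At ->].
    by have [/asboolP|/asboolP] := totA _ _ As At; [left|right].
  have both x y : (exists2 F, C F & x \in F) -> (exists2 F, C F & y \in F) ->
      exists F, [/\ C F, x \in F & y \in F].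
    move=> [F CF Fx] [G CG Gy].
    by have [s|s] := Cch _ _ CF CG; [exists G|exists F]; split => //; apply: s.
  have [|||U UP] := @mk_subfield (fun x => exists2 F, C F & x \in F).
  + by exists (fld t0); [exists t0 | rewrite rpred1].
  + by move=> x y Cx Cy; have [F [CF Fx Fy]] := both _ _ Cx Cy;
      exists F => //; rewrite rpredB.
  + by move=> x y Cx Cy; have [F [CF Fx Fy]] := both _ _ Cx Cy;
      exists F => //; rewrite rpred_div.
  have QU : Q U.
    apply: (Qch C) => //; first by exists (fld t0), t0.
    by move=> F [s _ ->]; case: (svalP s).
  have F0U : {subset F0 <= U}.
    move=> x F0x; apply/UP; exists (fld t0); first by exists t0.
    by case: (svalP t0) => _; apply.
  have [u uU] := mkT U QU F0U.
  exists u => s As; apply/asboolP => x sx.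
  by rewrite uU; apply/UP; exists (fld s) => //; exists s.
case: (svalP t) => Qt F0t; exists (fld t); split => // G tG QG.
have F0G : {subset F0 <= G} by move=> x /F0t /tG.
have [u uG] := mkT G QG F0G.
have /asboolP ut : R u t.
  by apply: maxt; apply/asboolP => x /tG; rewrite uG.
by move=> x; rewrite -uG => /ut.
Qed.

(** The minimum is over polynomials and roots together. A singleton [N] gives minimal polynomials;
    in the proof of Hensel's lemma, [N] is the set of elements with the same approximations as a
    given one. *)
Lemma min_poly_ex F (N : W -> Prop) :
  (exists f r, [/\ f \is a polyOver F, f != 0, root f r & N r]) ->
  exists g r, [/\ g \is a polyOver F, g != 0, root g r, N r &
    forall f s, f \is a polyOver F -> f != 0 -> root f s -> N s ->
      (size g <= size f)%N].
Proof.
move=> [f [r [Ff f0 fr Nr]]].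
pose P n := `[< exists f r, [/\ f \is a polyOver F, f != 0, root f r, N r & size f = n] >].
have exP : exists n, P n by exists (size f); apply/asboolP; exists f, r.
have [n /asboolP[g [s [Fg g0 gs Ns <-]]] minn] := ex_minnP exP.
exists g, s; split=> // h t Fh h0 ht Nt.
by apply: minn; apply/asboolP; exists h, t.
Qed.
End Subfields.

(** * Kummer theory inside a field *)

Section Minimal.
Variable W : fieldType.
Implicit Types (F G : divringClosed W) (x y r : W).

Definition is_minpoly F r (g : {poly W}) :=
  [/\ g \is a polyOver F, g != 0, root g r &
    forall f, f \is a polyOver F -> f != 0 -> root f r -> (size g <= size f)%N].

Lemma is_minpoly_dvd F r g f : is_minpoly F r g -> f \is a polyOver F ->
  root f r -> g %| f.
Proof.
case=> Fg g0 gr ming Ff fr; apply/modp_eq0P/eqP; apply: contraT => m0.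
have := ming (f %% g) (modp_subfield Ff Fg) m0.
rewrite leqNgt ltn_modpN0 //; apply.
rewrite rootE; move/eqP: fr; rewrite {1}(divp_eq f g) hornerD hornerM (eqP gr).
by rewrite mulr0 add0r => ->.
Qed.

(** A denominator q does not vanish at r, so neither does d = gcd(q, g). Hence g / d vanishes at r,
    minimality of g makes d constant, and Bezout's identity inverts q(r) by a polynomial value. *)
Lemma adjoins_minpoly F r g x : is_minpoly F r g -> adjoins F r x ->
  exists2 h, h \is a polyOver F & x = h.[r] /\ (size h < size g)%N.
Proof.
move=> mg [f [q [Ff Fq q0 ->]]]; have [Fg g0 gr ming] := mg.
suff [u Fu uq] : exists2 u, u \is a polyOver F & u.[r] * q.[r] = 1.
  exists ((f * u) %% g); first by rewrite modp_subfield // rpredM.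
  rewrite ltn_modpN0 //; split => //.
  have := congr1 (horner^~ r) (divp_eq (f * u) g).
  rewrite hornerD hornerM [in X in _ = X](hornerM _ g) (eqP gr) mulr0 add0r => <-.
  by congr (_ * _); rewrite -[LHS]mul1r -uq mulfK.
have [g' eg] := polyOver_sfield Fg; have [q' eq] := polyOver_sfield Fq.
have [[u v] /= uv] := Bezoutp q' g'.
pose d := gcdp q' g'.
have mapO (h : {poly sfield F}) : map_poly (val : sfield F -> W) h \is a polyOver F.
  by apply/polyOverP => i; rewrite coef_map /= sfvalP.
have g'0 : g' != 0 by move: g0; rewrite eg map_poly_eq0.
have d0 : d != 0 by rewrite gcdp_eq0 (negPf g'0) andbF.
have dr : (map_poly (val : sfield F -> W) d).[r] != 0.
  apply: contraNneq q0 => dr.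
  by rewrite eq; rewrite -(divpK (dvdp_gcdl q' g')) rmorphM hornerM /= dr mulr0.
have sd : size d = 1%N.
  have eg' := divpK (dvdp_gcdr q' g'); rewrite -/d in eg'.
  have e0 : g' %/ d != 0 by apply: contraNneq g'0 => e0; rewrite -eg' e0 mul0r.
  pose e := g' %/ d.
  have : (size g <= size (map_poly (val : sfield F -> W) e))%N.
    apply: ming => //; first by rewrite map_poly_eq0.
    move: gr; rewrite eg -{1}eg' rmorphM rootM => /orP[//|].
    by rewrite rootE (negPf dr).
  rewrite eg !size_map_poly -{1}eg' size_mul // -/e.
  have : (0 < size e)%N by rewrite size_poly_gt0.
  have : (0 < size d)%N by rewrite size_poly_gt0.
  case: (size d) => // -[//|k] _; case: (size e) => // l _.
  by rewrite addSn /= !addnS ltnS ltnNge leq_addr.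
have : size (u * q' + v * g') == 1 by rewrite (eqp_size uv) sd.
case/size_poly1P => c c0 ec.
have := congr1 (fun h : {poly sfield F} => (map_poly (val : sfield F -> W) h).[r]) ec.
rewrite rmorphD !rmorphM /= hornerD !hornerM -eq -eg (eqP gr) mulr0 addr0.
have -> : map_poly (sfval (F:=F)) c%:P = (val c)%:P by exact: (map_polyC (val : sfield F -> W)).
rewrite hornerC => e.
have vc : val c != 0 by rewrite -(rmorph0 (val : sfield F -> W)) (inj_eq val_inj).
exists ((val c)^-1 *: map_poly (val : sfield F -> W) u).
  by rewrite polyOverZ // rpredV sfvalP.
by rewrite hornerZ -mulrA e mulVf.
Qed.

End Minimal.

Lemma prime_root_coprime (W : fieldType) (F : divringClosed W) (p m : nat) (y : W) :
  prime p -> ~~ (p %| m)%N -> y ^+ p \in F -> y ^+ m \in F -> y \in F.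
Proof.
move=> p_pr pm Fp Fm.
have m0 : (0 < m)%N by case: m pm {Fm}; rewrite ?dvdn0.
have [->|y0] := eqVneq y 0; first by rewrite rpred0.
case: (egcdnP p m0) => u v e _.
have cop : gcdn m p = 1%N.
  by apply/eqP; rewrite gcdnC -[_ == _]/(coprime p m) prime_coprime.
have -> : y = (y ^+ m) ^+ u / (y ^+ p) ^+ v.
  rewrite -!exprM mulnC e cop exprD expr1 mulnC.
  by rewrite mulrAC mulfV ?mul1r // expf_neq0.
by rewrite rpred_div // rpredX.
Qed.

Section Kummer.
Variables (W : fieldType) (p : nat) (xi : W).
Hypotheses (p_pr : prime p) (xiP : p.-primitive_root xi).
Implicit Types (F G : divringClosed W) (x y r : W).

Let p_gt0 : (0 < p)%N := prime_gt0 p_pr.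

Lemma Xn_sub_factor y : y != 0 ->
  'X^p - (y ^+ p)%:P = \prod_(0 <= i < p) ('X - (xi ^+ i * y)%:P).
Proof.
move=> y0.
have mon : ('X^p - (y ^+ p)%:P : {poly W}) \is monic.
  by rewrite monicXnsubC.
have -> : \prod_(0 <= i < p) ('X - (xi ^+ i * y)%:P) =
    \prod_(z <- [seq xi ^+ i * y | i <- index_iota 0 p]) ('X - z%:P).
  by rewrite big_map.
rewrite [LHS](@all_roots_prod_XsubC _ _ [seq xi ^+ i * y | i <- index_iota 0 p]).
- by rewrite (monicP mon) scale1r.
- by rewrite size_XnsubC // size_map size_iota subn0.
- apply/allP => _ /mapP[i _ ->]; rewrite rootE !hornerE exprMn -exprM mulnC exprM.
  by rewrite (prim_expr_order xiP) expr1n mul1r subrr.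
- rewrite uniq_rootsE map_inj_in_uniq ?iota_uniq // => i j.
  rewrite !mem_index_iota /= => ip jp /(mulIf y0)/eqP.
  by rewrite (eq_prim_root_expr xiP) !modn_small // => /eqP.
Qed.

(** The minimal polynomial of y divides X^p - y^p, so it is a product of k factors X - xi^i y up to
    a scalar. If k < p, its constant term puts y^k in F, and y follows because k is prime to p. *)
Lemma Kummer_minpoly F y : xi \in F -> y ^+ p \in F -> y \notin F ->
  is_minpoly F y ('X^p - (y ^+ p)%:P).
Proof.
move=> Fxi Fyp Fy; have y0 : y != 0 by apply: contraNneq Fy => ->; rewrite rpred0.
have FM : 'X^p - (y ^+ p)%:P \is a polyOver F.
  by rewrite rpredB ?polyOverC // rpredX // polyOverX.
have M0 : 'X^p - (y ^+ p)%:P != 0 by rewrite monic_neq0 ?monicXnsubC.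
have My : root ('X^p - (y ^+ p)%:P) y by rewrite rootE !hornerE subrr.
split=> // f Ff f0 fr; rewrite size_XnsubC //.
have [|g [r [Fg g0 gr er ming]]] := @min_poly_ex W F (fun r => r = y).
  by exists f, y.
rewrite {r}er in gr; apply: leq_trans (ming f y Ff f0 fr (erefl _)).
have mg : is_minpoly F y g by split=> // h Fh h0 hr; apply: ming (erefl _).
have := is_minpoly_dvd mg FM My; rewrite Xn_sub_factor //.
case/dvdp_prod_XsubC => msk gE.
set I := mask msk _ in gE; have szI := eqp_size gE.
rewrite size_prod_XsubC in szI; rewrite szI ltnS leqNgt.
apply/negP => szp; have szI0 : (0 < size I)%N.
  by have := root_size_gt1 g0 gr; rewrite szI ltnS.
case/negP: Fy; apply: (@prime_root_coprime _ F p (size I)) => //.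
  by rewrite gtnNdvd.
have [[c d] /= /andP[c0 d0] cd] := eqpP _ _ gE.
have e := congr1 (fun h : {poly W} => lead_coef h) cd.
rewrite !lead_coefZ (monicP (monic_prod_XsubC _ _ _)) mulr1 in e.
have := congr1 (fun h : {poly W} => h.[0]) cd.
rewrite !hornerZ -e horner_prod -mulrA => /(mulfI c0) e2.
have FI : \prod_(i <- I) ('X - (xi ^+ i * y)%:P).[0] \in F.
  have -> : \prod_(i <- I) ('X - (xi ^+ i * y)%:P).[0] = g.[0] / lead_coef g.
    by rewrite e2 mulrAC mulfV ?mul1r // lead_coef_eq0.
  by rewrite rpred_div ?rpred_horner ?rpred0 //; apply: (polyOverP Fg).
have FP (s : seq nat) : exists2 c, c \in F & c != 0 /\
   \prod_(i <- s) ('X - (xi ^+ i * y)%:P).[0] = c * y ^+ size s.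
  elim: s => [|i s [c' Fc [c'0 IH]]]; first by exists 1; rewrite ?rpred1 ?oner_eq0 // big_nil mul1r.
  exists (- xi ^+ i * c'); first by rewrite rpredM ?rpredN ?rpredX.
  split.
    by rewrite mulf_neq0 // oppr_eq0 expf_neq0 // (prim_root_eq0 xiP) -lt0n.
  by rewrite big_cons IH !hornerE /= exprS; ring.
have [c' Fc [c'0 eI]] := FP I.
have -> : y ^+ size I = (\prod_(i <- I) ('X - (xi ^+ i * y)%:P).[0]) / c'.
  by rewrite eI mulrC mulKf.
by rewrite rpred_div.
Qed.

(** Evaluation at the conjugate xi y replaces a Galois action: if w = h(y), then h^p - w^p is
    divisible by X^p - y^p, so h(xi y) is w times a p-th root of unity xi^k. *)
Lemma Kummer_root F y w : xi \in F -> y ^+ p \in F -> y \notin F ->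
  adjoins F y w -> w ^+ p \in F -> exists2 m, (m < p)%N & exists2 f, f \in F & w = f * y ^+ m.
Proof.
move=> Fxi Fyp Fy aw Fwp; have M := Kummer_minpoly Fxi Fyp Fy.
have [w0|w0] := eqVneq w 0.
  by exists 0%N => //; exists 0; rewrite ?rpred0 // mul0r.
have [h Fh [we sh]] := adjoins_minpoly M aw.
rewrite size_XnsubC // ltnS in sh.
have Fq : h ^+ p - (w ^+ p)%:P \is a polyOver F by rewrite rpredB ?rpredX ?polyOverC.
have := is_minpoly_dvd M Fq; rewrite {1}rootE !hornerE -we subrr eqxx => /(_ isT).
move=> /(dvdp_trans _) dv.
have e1 : h.[xi * y] ^+ p = w ^+ p.
  have : root (h ^+ p - (w ^+ p)%:P) (xi * y).
    rewrite -dvdp_XsubCl dv // dvdp_XsubCl rootE !hornerE exprMn.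
    by rewrite (prim_expr_order xiP) mul1r subrr.
  by rewrite rootE !hornerE subr_eq0 => /eqP.
have : (h.[xi * y] / w) ^+ p = 1 by rewrite expr_div_n e1 mulfV // expf_neq0.
case/(prim_rootP xiP) => k ek.
exists k => //.
(* q = h(xi X) - xi^k h(X) vanishes at y and has degree below p, so it is zero, and h has no term
   other than that of X^k. *)
pose q := \poly_(i < size h) (h`_i * (xi ^+ i - xi ^+ k)).
have Fq' : q \is a polyOver F.
  apply/polyOverP => i; rewrite coef_poly; case: ifP => _; last by rewrite rpred0.
  by rewrite rpredM ?rpredB ?rpredX // (polyOverP Fh).
have q0 : q = 0.
  apply/eqP; apply: contraT => q0; case: M => _ _ _ /(_ q Fq' q0).
  rewrite size_XnsubC // rootE => H; have : (p < size q)%N.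
    apply: H; rewrite horner_poly.
    have -> : \sum_(i < size h) h`_i * (xi ^+ i - xi ^+ k) * y ^+ i =
       h.[xi * y] - xi ^+ k * h.[y].
      rewrite !horner_coef mulr_sumr -sumrB; apply: eq_bigr => i _.
      by rewrite exprMn; ring.
    by rewrite -ek -we divfK // subrr.
  by rewrite ltnNge (leq_trans (size_poly _ _)).
exists h`_k; first exact: (polyOverP Fh).
have hk i : (i < size h)%N -> i != k :> nat -> h`_i = 0.
  move=> ih ik; have := congr1 (fun q : {poly W} => q`_i) q0.
  rewrite coef_poly ih coef0 => /eqP; rewrite mulf_eq0 => /orP[/eqP//|].
  rewrite subr_eq0 (eq_prim_root_expr xiP) !modn_small //; last exact: leq_trans sh.
  by rewrite (negPf ik).
rewrite we horner_coef.
have [kh|kh] := ltnP k (size h).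
  rewrite (bigD1 (Ordinal kh)) //= big1 ?addr0 // => i ik.
  by rewrite hk ?mul0r //.
rewrite (nth_default 0 kh) mul0r big1 // => i _.
by rewrite hk ?mul0r // neq_ltn (leq_trans _ kh).
Qed.

Definition pindep (E : Type) (T : E -> W) F :=
  forall (n : nat) (s : 'I_n -> E) (k : 'I_n -> nat) f, injective s -> f \in F ->
    \prod_(j < n) T (s j) ^+ k j = f ^+ p -> forall j, (p %| k j)%N.

Definition pspan (E : Type) (T : E -> W) F c :=
  exists (n : nat) (s : 'I_n -> E) (k : 'I_n -> nat) f,
    [/\ injective s, f \in F & c = \prod_(j < n) T (s j) ^+ k j * f ^+ p].

Lemma pspan_pth (E : Type) (T : E -> W) F f : f \in F -> pspan T F (f ^+ p).
Proof.
move=> Ff; have s0 : 'I_0 -> E by case.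
exists 0%N, s0, (fun=> 0%N), f; split => //; first by case.
by rewrite big_ord0 mul1r.
Qed.

(** Adjoining y to the maximal F would create a relation between the T_i modulo p-th powers of F(y).
    By [Kummer_root] it reads prod T_i^k_i = (f y^m)^p; if p divides m it is already a relation in
    F, and otherwise it can be solved for y^p. *)
Lemma Kummer_Zorn (E : Type) (T : E -> W) (F0 H : divringClosed W) :
  xi \in F0 -> (forall i, T i \in F0) -> (forall i, T i != 0) ->
  {subset F0 <= H} -> pindep T F0 ->
  exists F : divringClosed W, [/\ {subset F0 <= F}, {subset F <= H}, pindep T F &
    forall y, y \in H -> y ^+ p \in F -> pspan T F (y ^+ p)].
Proof.
move=> xi0 T0 Tn0 F0H ind0.
have [||F [F0F [FH indF] maxF]] := @subfield_Zorn W
  (fun F => {subset F <= H} /\ pindep T F) F0.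
- by [].
- move=> C _ CQ _ G GP; split=> [x /GP[F /CQ[FH _] /FH]//|].
  by move=> n s k f inj_s /GP[F /CQ[_]]; apply.
exists F; split=> // y Hy Fyp.
have Fxi : xi \in F by apply: F0F.
have [Fy|Fy] := boolP (y \in F); first exact: pspan_pth.
apply: contrapT => nsp; have [G GP] := adjoin_ex F y.
case/negP: Fy; apply: (maxF G).
- by move=> x Fx; apply/GP/adjoins_base.
- split=> [x /GP|n s k w inj_s /GP aw ew]; first exact: adjoins_min.
  have /negP Fy : ~ y \in F by move=> Fy; apply: nsp; exact: pspan_pth.
  have FT : w ^+ p \in F.
    by rewrite -ew rpred_prod // => j _; rewrite rpredX //; apply: F0F.
  have [m mp [f Ff we]] := Kummer_root Fxi Fyp Fy aw FT.
  have [pm|pm] := boolP (p %| m)%N.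
    apply: (indF n s k w inj_s) => //.
    by rewrite we rpredM // -(divnK pm) mulnC exprM rpredX.
  have m0 : (0 < m)%N by case: m pm {we mp}; rewrite ?dvdn0.
  have [u v euv _] := egcdnP p m0; case: nsp.
  have cop : gcdn m p = 1%N.
    by apply/eqP; rewrite gcdnC -[_ == _]/(coprime p m) prime_coprime.
  have w0 : w ^+ p != 0.
    by rewrite -ew prodf_seq_neq0; apply/allP => j _; rewrite expf_neq0.
  have f0 : f != 0 by apply: contraNneq w0 => f0; rewrite we f0 mul0r expr0n gtn_eqF.
  have y0 : y != 0 by apply: contraNneq Fy => ->; rewrite rpred0.
  (* From m u = v p + 1 comes y = (y^m)^u / (y^p)^v, where y^m = w / f and w^p is the product of the
     T_i. *)
  exists n, s, (fun j => k j * u)%N, (f ^- u * (y ^+ p) ^- v); split=> //.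
    by rewrite rpredM // rpredV rpredX.
  under eq_bigr do rewrite exprM.
  have e : (y ^+ m) ^+ u = (y ^+ p) ^+ v * y.
    by rewrite -!exprM mulnC euv cop exprD expr1 mulnC.
  rewrite prodrXl ew we [X in X * _](exprAC _ p u) -exprMn; congr (_ ^+ p).
  rewrite exprMn e mulrACA mulfV ?expf_neq0 // mul1r mulrAC mulfV ?mul1r //.
  by rewrite !expf_neq0.
- by apply/GP/adjoins_gen.
Qed.
End Kummer.

(** * Valuations and leading terms *)

Lemma closed_root (W : closedFieldType) (p : nat) (c : W) : (0 < p)%N -> exists g, g ^+ p = c.
Proof.
move=> p_gt0.
have [g eg] := @solve_monicpoly W p (fun i => if i == 0%N then c else 0) p_gt0.
exists g; rewrite eg; case: p p_gt0 {eg} => // n _; rewrite big_ord_recl /= mulr1 big1 ?addr0 //.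
by move=> i _; rewrite mul0r.
Qed.

(* m is the maximal ideal of a valuation ring of W, namely of the ring of the
   x such that x = 0 or x^-1 is not in m. *)
Record val_ideal (W : fieldType) (m : W -> Prop) : Prop := ValIdeal {
  val0 : m 0;
  val1 : ~ m 1;
  valD : forall x y, m x -> m y -> m (x + y);
  valM : forall x y, m x -> ~ m y^-1 -> m (x * y);
  valV : forall x, m x -> x != 0 -> ~ m x^-1 }.

Section Valuation.
Variables (W : fieldType) (m : W -> Prop).
Hypothesis mP : val_ideal m.
Implicit Types x y z : W.

(** [vlt x y] is |x| < |y|, and [vsim x y] is equality of leading terms: x / y is a 1-unit, which
    forces both to be nonzero. *)
Definition vlt x y := y != 0 /\ m (x / y).
Definition vsim x y := vlt (x - y) y.

Lemma valN1 : ~ m (- 1).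
Proof.
move=> h; have := valV mP h; rewrite oppr_eq0 oner_eq0 => /(_ isT).
by rewrite invrN invr1.
Qed.

Lemma valN x : m x -> m (- x).
Proof.
by move=> h; rewrite -mulrN1; apply: (valM mP) => //; rewrite invrN invr1; exact: valN1.
Qed.

Lemma valMm x y : m x -> m y -> m (x * y).
Proof.
move=> mx my; have [->|y0] := eqVneq y 0; first by rewrite mulr0; exact: val0 mP.
by apply: (valM mP) => //; apply: (valV mP).
Qed.

Lemma val_prime x y : m (x * y) -> m x \/ m y.
Proof.
move=> mxy; have [my|my] := pselect (m y); [by right|left].
have y0 : y != 0 by apply: contra_notN my => /eqP ->; exact: val0 mP.
by rewrite -(mulfK y0 x); apply: (valM mP); rewrite ?invrK.
Qed.

Lemma vlt_trans y x z : vlt x y -> vlt y z -> vlt x z.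
Proof.
move=> [y0 xy] [z0 yz]; split => //.
have -> : x / z = (x / y) * (y / z) by rewrite mulrA divfK.
exact: valMm.
Qed.

Lemma vltxx x : ~ vlt x x.
Proof. by move=> [x0]; rewrite mulfV //; exact: val1 mP. Qed.

Lemma vlt0 y : y != 0 -> vlt 0 y.
Proof. by split=> //; rewrite mul0r; exact: val0 mP. Qed.

Lemma vltNl x y : vlt x y -> vlt (- x) y.
Proof. by move=> [y0 h]; split=> //; rewrite mulNr; exact: valN. Qed.

Lemma vltNr x y : vlt x y -> vlt x (- y).
Proof. by move=> [y0 h]; split; rewrite ?oppr_eq0 // invrN mulrN; exact: valN. Qed.

Lemma vltD x y z : vlt x z -> vlt y z -> vlt (x + y) z.
Proof. by move=> [z0 xz] [_ yz]; split=> //; rewrite mulrDl; exact: (valD mP). Qed.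

(** The weak inequality |y| <= |z| is written as the negation of [vlt z y], here and below. *)
Lemma vlt_le_trans y x z : vlt x y -> ~ vlt z y -> vlt x z.
Proof.
move=> [y0 xy] nzy; have [z0|z0] := eqVneq z 0.
  by case: nzy; split=> //; rewrite z0 mul0r; exact: val0 mP.
split=> //; have -> : x / z = (x / y) * (y / z) by rewrite mulrA divfK.
by apply: (valM mP) => //; rewrite invf_div => h; apply: nzy.
Qed.

Lemma vle_lt_trans y x z : ~ vlt y x -> vlt y z -> vlt x z.
Proof.
move=> nyx [z0 yz]; have [->|x0] := eqVneq x 0; first exact: vlt0.
split=> //; have [y0|y0] := eqVneq y 0.
  by case: nyx; rewrite y0; exact: vlt0.
have -> : x / z = (y / z) * (x / y) by rewrite [RHS]mulrC mulrA (divfK y0).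
by apply: (valM mP) => //; rewrite invf_div => h; apply: nyx.
Qed.

Lemma vltMl u x y : u != 0 -> vlt x y -> vlt (u * x) (u * y).
Proof.
move=> u0 [y0 h]; split; first by rewrite mulf_neq0.
by rewrite -mulf_div mulfV // mul1r.
Qed.

Lemma vsim_neq0l x y : vsim x y -> x != 0.
Proof.
move=> [y0]; apply: contraPneq => ->; rewrite sub0r mulNr mulfV //.
exact: valN1.
Qed.

Lemma vsim_neq0r x y : vsim x y -> y != 0. Proof. by case. Qed.

Lemma vsim_refl x : x != 0 -> vsim x x.
Proof. by move=> x0; rewrite /vsim subrr; exact: vlt0. Qed.

Lemma vsim_addr x y : vlt x y -> vsim (y + x) y.
Proof. by rewrite /vsim addrAC subrr add0r. Qed.

Lemma vlt_simr x y z : vlt x y -> vsim y z -> vlt x z.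
Proof.
move=> xy [z0 yz]; apply: (vlt_le_trans xy) => -[y0 zy].
have e : z / y * ((y - z) / z + 1) = 1 by field; rewrite y0 z0.
apply: (val1 mP); rewrite -e mulrDr mulr1; apply: (valD mP) => //.
exact: valMm.
Qed.

Lemma vsim_sym x y : vsim x y -> vsim y x.
Proof.
move=> h; have x0 := vsim_neq0l h; have y0 := vsim_neq0r h.
apply: contrapT => n; apply: (@vltxx y).
have n' : ~ vlt (x - y) x by move=> h'; apply: n; rewrite /vsim -opprB; exact: vltNl.
have lxy : vlt x y by exact: vle_lt_trans n' h.
by have := vltD (vltNl h) lxy; rewrite opprB subrK.
Qed.

Lemma vsim_trans y x z : vsim x y -> vsim y z -> vsim x z.
Proof.
move=> xy yz; rewrite /vsim.
have -> : x - z = (x - y) + (y - z) by ring.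
by apply: vltD => //; apply: vlt_simr yz.
Qed.

Lemma vsimM x y x' y' : vsim x y -> vsim x' y' -> vsim (x * x') (y * y').
Proof.
move=> h h'; apply: (@vsim_trans (y * x')).
  rewrite /vsim -mulrBl ![_ * x']mulrC; apply: vltMl h; exact: vsim_neq0l h'.
rewrite /vsim -mulrBr; apply: vltMl h'; exact: vsim_neq0r h.
Qed.

Lemma vsimV x y : vsim x y -> vsim x^-1 y^-1.
Proof.
move=> /vsim_sym h; have x0 := vsim_neq0r h; have y0 := vsim_neq0l h.
case: h => _ h; split; first by rewrite invr_eq0.
have -> // : (x^-1 - y^-1) / y^-1 = (y - x) / x.
by rewrite !mulrBl !mulfV ?invr_eq0 // invrK [in LHS]mulrC.
Qed.

Lemma vsimX x y n : vsim x y -> vsim (x ^+ n) (y ^+ n).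
Proof.
move=> h; elim: n => [|n IH]; first by rewrite !expr0; apply: vsim_refl; exact: oner_neq0.
by rewrite !exprS; apply: vsimM.
Qed.

Lemma vsim_prod (I : eqType) (s : seq I) (f g : I -> W) :
  (forall i, i \in s -> vsim (f i) (g i)) -> vsim (\prod_(i <- s) f i) (\prod_(i <- s) g i).
Proof.
elim: s => [|i s IH] h; first by rewrite !big_nil; apply: vsim_refl; exact: oner_neq0.
rewrite !big_cons; apply: vsimM; first by apply: h; rewrite mem_head.
by apply: IH => j js; apply: h; rewrite in_cons js orbT.
Qed.

Lemma vsim1E x : vsim x 1 <-> m (x - 1).
Proof.
rewrite /vsim /vlt divr1; split=> [[]//|h]; split=> //; exact: oner_neq0.
Qed.

Lemma vsim_div x y : y != 0 -> vsim x y -> vsim (x / y) 1.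
Proof.
by move=> y0 h; rewrite -(mulfV y0); apply: vsimM h _; apply: vsim_refl; rewrite invr_eq0.
Qed.

Definition dominated (G : W -> Prop) (H : divringClosed W) :=
  forall h, h \in H -> h != 0 -> exists2 g, G g & vsim h g.

End Valuation.

Lemma vlt_siml (W : fieldType) (m : W -> Prop) (mP : val_ideal m) y x z :
  vsim m x y -> vlt m y z -> vlt m x z.
Proof.
move=> xy yz; rewrite -(subrK y x); apply: vltD => //.
exact: vlt_trans yz.
Qed.

(** * Hensel's lemma for p-th roots of 1-units *)

Section Hensel.
Variables (W : closedFieldType) (m : W -> Prop) (p : nat) (xi : W).
Hypotheses (mP : val_ideal m) (p_pr : prime p) (xiP : p.-primitive_root xi).
Variables (G : W -> Prop) (H : divringClosed W).
Hypotheses (GM : forall x y, G x -> G y -> G (x * y)) (GV : forall x, G x -> G x^-1).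
Hypotheses (Hxi : xi \in H) (xim : forall i, (0 < i < p)%N -> ~ m (1 - xi ^+ i)).
Hypotheses (domH : dominated m G H)
  (maxH : forall H' : divringClosed W, {subset H <= H'} -> dominated m G H' -> {subset H' <= H}).

Let p_gt0 : (0 < p)%N := prime_gt0 p_pr.

(** For any root g0, the product of the 1 - xi^i g0 is 1 - c, which lies in the prime ideal m; a
    factor in m singles out the root xi^i g0. *)
Lemma unit_root_ex c : vsim m c 1 -> exists2 g, vsim m g 1 & g ^+ p = c.
Proof.
move=> c1; have c0 := vsim_neq0l mP c1.
have [g0 eg0] := closed_root c p_gt0.
have g00 : g0 != 0 by apply: contraNneq c0 => g00; rewrite -eg0 g00 expr0n gtn_eqF.
have := congr1 (fun f : {poly W} => f.[1]) (Xn_sub_factor p_pr xiP g00).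
rewrite !hornerE expr1n horner_prod eg0 => e.
suff [i mi] : exists i, m (1 - xi ^+ i * g0).
  exists (xi ^+ i * g0); first by apply/vsim1E; rewrite -opprB; apply: valN.
  by rewrite exprMn -exprM mulnC exprM (prim_expr_order xiP) expr1n mul1r.
have : m (\prod_(0 <= i < p) ('X - (xi ^+ i * g0)%:P).[1]).
  by rewrite -e -opprB; apply: valN => //; apply/vsim1E.
elim: (index_iota 0 p) => [|i s IH]; first by rewrite big_nil => /(val1 mP).
rewrite big_cons => /(val_prime mP)[|//]; rewrite !hornerE => h.
by exists i.
Qed.

Section Step.
Variables (c g : W).
Hypotheses (Hc : c \in H) (g1 : vsim m g 1) (gc : g ^+ p = c) (Hg : g \notin H).

Let gh h : h \in H -> g - h != 0.
Proof. by move=> Hh; apply: contraNneq Hg => /eqP; rewrite subr_eq0 => /eqP ->. Qed.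

(** If h is not a 1-unit, g - h has the leading term of 1 - h. Otherwise c - h^p is the product of
    the g - xi^i h; for 0 < i < p these have the leading terms of 1 - xi^i, units by [xim], so g - h
    has the leading term of a quotient in H. *)
Lemma approx h : h \in H -> exists2 h', h' \in H & vsim m (g - h) h'.
Proof.
move=> Hh; have [h1|h1] := pselect (m (h - 1)); last first.
  exists (1 - h); first by rewrite rpredB ?rpred1.
  have -> : g - h = (1 - h) + (g - 1) by ring.
  apply: vsim_addr; apply: (@vlt_le_trans _ _ mP 1); first exact: g1.
  case=> _; rewrite divr1 -opprB => h2; apply: h1; rewrite -[h - 1]opprK.
  exact: valN.
have {}h1 : vsim m h 1 by apply/vsim1E.
have h0 := vsim_neq0l mP h1.
have := congr1 (fun f : {poly W} => f.[g]) (Xn_sub_factor p_pr xiP h0).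
rewrite !hornerE gc horner_prod big_ltn // !hornerE ?expr0 ?mul1r => e.
set r := \prod_(_ <= _ < _) _ in e; pose d := \prod_(1 <= i < p) (1 - xi ^+ i).
have rd : vsim m r d.
  apply: vsim_prod => // i; rewrite mem_index_iota => ip; rewrite !hornerE.
  have -> : g - xi ^+ i * h = (1 - xi ^+ i) + ((g - 1) - xi ^+ i * (h - 1)) by ring.
  apply: vsim_addr; apply: (@vlt_le_trans _ _ mP 1); last first.
    by case=> _; rewrite divr1; apply: xim.
  apply: vltD g1 (vltNl mP _) => //.
  case: h1 => _; rewrite divr1 => h1; split; first exact: oner_neq0.
  rewrite divr1 mulrC; apply: (valM mP) => //.
  move=> h2; apply: (val1 mP).
  have : m ((xi ^+ i)^-1 ^+ p).
    elim: p p_gt0 => // -[|n] IH _; first by rewrite expr1.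
    by rewrite exprS; apply: valMm => //; apply: IH.
  by rewrite exprVn -exprM mulnC exprM (prim_expr_order xiP) expr1n invr1.
exists ((c - h ^+ p) / d).
  rewrite rpred_div ?rpredB ?rpredX // rpred_prod // => i _.
  by rewrite rpredB ?rpred1 ?rpredX.
have r0 := vsim_neq0l mP rd.
have -> : g - h = (c - h ^+ p) / r by rewrite e mulfK.
apply: vsimM => //; last exact: vsimV.
by apply: vsim_refl => //; rewrite e mulf_neq0 // gh.
Qed.

(** Adding to h an element of H with the leading term of g - h gives a closer approximation, so
    there is no closest one. *)
Lemma improve h : h \in H -> exists2 h', h' \in H & vlt m (g - h') (g - h).
Proof.
move=> Hh; have [h' Hh' gh'] := approx Hh; exists (h + h'); first by rewrite rpredD.
by rewrite opprD addrA; apply: vlt_simr gh' (vsim_sym mP gh').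
Qed.

(** Then r - h and g - h have the same leading term for every h in H: the field H cannot tell r from
    g. *)
Let near r := forall h, h \in H -> vlt m (r - g) (g - h).

(** For each r that is not near, some element of H is at least as close to g as r is, and strictly
    closer after [improve]. Of finitely many such elements, the one closest to g serves all r. *)
Lemma approx_roots (rs : seq W) : (forall r, r \in rs -> ~ near r) ->
  exists2 h, h \in H & forall r, r \in rs -> vlt m (g - h) (g - r).
Proof.
elim: rs => [|r rs IH] nr; first by exists 0; rewrite ?rpred0.
have [|h1 Hh1 h1P] := IH; first by move=> s srs; apply: nr; rewrite in_cons srs orbT.
have /existsNP[h0 /not_implyP[Hh0 nh0]] := nr r (mem_head _ _).
have [h2 Hh2 lt20] := improve Hh0.
have lt2r : vlt m (g - h2) (g - r).
  by rewrite -[g - r]opprB; apply: vltNr => //; apply: vlt_le_trans lt20 nh0.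
have [l|l] := pselect (vlt m (g - h1) (g - h2)).
  exists h1 => // s; rewrite in_cons => /predU1P[->|/h1P//]; exact: vlt_trans lt2r.
exists h2 => // s; rewrite in_cons => /predU1P[->//|/h1P h].
exact: vle_lt_trans l h.
Qed.

(** With h closer to g than every root r of f, the differences rho - r, g - r and h - r share their
    leading term, so f(rho) has the leading term of f(h). *)
Lemma near_root_approx (f : {poly W}) rho : f \is a polyOver H -> f != 0 -> near rho ->
  (forall r, root f r -> ~ near r) -> exists2 h, h \in H & vsim m f.[rho] h.
Proof.
move=> Hf f0 nrho nf; have [rs ef] := closed_field_poly_normal f.
have l0 : lead_coef f != 0 by rewrite lead_coef_eq0.
have rf r : r \in rs -> root f r.
  by rewrite ef rootZ // root_prod_XsubC.
have [|h Hh hP] := @approx_roots rs; first by move=> r /rf /nf.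
exists f.[h]; first by rewrite rpred_horner.
rewrite ef !hornerZ !horner_prod; apply: vsimM => //; first exact: vsim_refl.
apply: vsim_prod => // r /hP l; rewrite !hornerE.
apply: (@vsim_trans _ _ mP (g - r)).
  have -> : rho - r = (g - r) + (rho - g) by ring.
  by apply: vsim_addr; apply: vlt_trans l => //; apply: nrho.
apply: vsim_sym => //; have -> : h - r = (g - r) - (g - h) by ring.
by apply: vsim_addr; apply: vltNl.
Qed.

Lemma Hensel_step : False.
Proof.
have nearH r : near r -> r \in H -> False.
  move=> nr Hr; apply: (@vltxx _ _ mP (r - g)).
  by rewrite -{2}[r - g]opprK opprB; apply: vltNr => //; apply: nr.
have [|q [rho [Hq q0 qrho nrho minq]]] := @min_poly_ex W H near.
  exists ('X^p - c%:P), g; split.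
  - by rewrite rpredB ?polyOverC // rpredX // polyOverX.
  - by rewrite monic_neq0 ?monicXnsubC.
  - by rewrite rootE !hornerE gc subrr.
  - by move=> h Hh; rewrite subrr; apply: vlt0 => //; exact: gh.
have [H' H'P] := adjoin_ex H rho.
apply: (nearH rho nrho); apply: (maxH (H' := H')); last 1 first.
- exact/H'P/adjoins_gen.
- by move=> x Hx; apply/H'P/adjoins_base.
(* The remainder of f modulo q has smaller degree than q, so by minimality none of its roots is
   near. *)
have val f : f \is a polyOver H -> f.[rho] != 0 -> exists2 h, h \in H & vsim m f.[rho] h.
  move=> Hf f0; have e : f.[rho] = (f %% q).[rho].
    by rewrite {1}(divp_eq f q) hornerD hornerM (eqP qrho) mulr0 add0r.
  rewrite e in f0 *; have Hm := modp_subfield Hf Hq.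
  have m0 : f %% q != 0 by apply: contraNneq f0 => ->; rewrite horner0.
  apply: near_root_approx => // r fr nr.
  by have := minq _ _ Hm m0 fr nr; rewrite leqNgt ltn_modpN0.
move=> x /H'P[f1 [f2 [Hf1 Hf2 f20 ->]]] x0.
have f10 : f1.[rho] != 0 by apply: contraNneq x0 => ->; rewrite mul0r.
have [h1 Hh1 s1] := val _ Hf1 f10; have [h2 Hh2 s2] := val _ Hf2 f20.
have [g1' Gg1 sg1] := domH Hh1 (vsim_neq0r s1).
have [g2' Gg2 sg2] := domH Hh2 (vsim_neq0r s2).
exists (g1' / g2'); first by apply: GM => //; apply: GV.
apply: vsimM => //; first exact: vsim_trans s1 sg1.
by apply: vsimV => //; exact: vsim_trans s2 sg2.
Qed.

End Step.

(* Kaplansky's argument: a 1-unit root missing from H could be approximated from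
   H without a best approximation, and adjoining an element of least degree
   with the same approximations would be an immediate extension of H. *)
Lemma Hensel c : c \in H -> vsim m c 1 -> exists2 h, h \in H & h ^+ p = c.
Proof.
move=> Hc c1; have [g g1 gc] := unit_root_ex c1.
have [Hg|Hg] := boolP (g \in H); first by exists g.
by case: (Hensel_step Hc g1 gc Hg).
Qed.

End Hensel.

Lemma dominated_maximal (W : fieldType) (m : W -> Prop) (G : W -> Prop)
    (H0 : divringClosed W) : dominated m G H0 ->
  exists H : divringClosed W, [/\ {subset H0 <= H}, dominated m G H &
    forall H' : divringClosed W, {subset H <= H'} -> dominated m G H' -> {subset H' <= H}].
Proof.
move=> d0; apply: (subfield_Zorn d0) => C _ Cd _ H HP h /HP[F /Cd].
exact.
Qed.

(** * Fields generated by monomials *)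

Section Monomials.
Variables (W : fieldType) (J : eqType) (x : J -> W).

(** The list may contain indices with exponent zero, so two monomials can always be written over a
    common list. *)
Definition supp (n : J -> int) (s : seq J) := uniq s /\ forall j, n j != 0 -> j \in s.
Definition mon (s : seq J) (n : J -> int) := \prod_(j <- s) x j ^ n j.

Lemma mon_ext n s t : supp n s -> supp n t -> mon s n = mon t n.
Proof.
move=> [us hs] [ut ht]; rewrite /mon (bigID (fun j => n j != 0)) [RHS](bigID (fun j => n j != 0)) /=.
rewrite [X in _ * X]big1 => [|j /negPn/eqP ->]; last by rewrite expr0z.
rewrite [X in _ = _ * X]big1 => [|j /negPn/eqP ->]; last by rewrite expr0z.
rewrite !mulr1 -big_filter -[RHS]big_filter; apply: perm_big.
apply: uniq_perm; rewrite ?filter_uniq // => j; rewrite !mem_filter.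
by case: eqP => //= /eqP nj; rewrite hs ?ht.
Qed.

Lemma supp_catl n n' s t : supp n s -> supp n' t -> supp n (undup (s ++ t)).
Proof.
move=> [us hs] [ut ht]; split; first exact: undup_uniq.
by move=> j /hs js; rewrite mem_undup mem_cat js.
Qed.

Lemma supp_catr n n' s t : supp n s -> supp n' t -> supp n' (undup (s ++ t)).
Proof.
move=> [us hs] [ut ht]; split; first exact: undup_uniq.
by move=> j /ht js; rewrite mem_undup mem_cat js orbT.
Qed.

Lemma suppD n n' s : supp n s -> supp n' s -> supp (fun j => n j + n' j) s.
Proof.
move=> [us hs] [_ hs']; split=> // j.
have [e|/hs//] := eqVneq (n j) 0; rewrite e add0r; exact: hs'.
Qed.

Lemma suppN n s : supp n s -> supp (fun j => - n j) s.
Proof. by move=> [us hs]; split=> // j; rewrite oppr_eq0; exact: hs. Qed.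

Definition unitv (j : J) (i : J) : int := if i == j then 1 else 0.

Lemma supp_unitv j : supp (unitv j) [:: j].
Proof.
by split=> // i; rewrite /unitv inE; case: ifP => //; rewrite eqxx.
Qed.

Lemma mon_unitv j : mon [:: j] (unitv j) = x j.
Proof. by rewrite /mon big_seq1 /unitv eqxx expr1z. Qed.

Hypothesis x0 : forall j, x j != 0.

Lemma mon_neq0 s n : mon s n != 0.
Proof. by rewrite prodf_seq_neq0; apply/allP => j _; rewrite expfz_neq0. Qed.

Lemma monD s n n' : mon s (fun j => n j + n' j) = mon s n * mon s n'.
Proof. by rewrite -big_split; apply: eq_bigr => j _; rewrite expfzDr. Qed.

Lemma monN s n : mon s (fun j => - n j) = (mon s n)^-1.
Proof. by rewrite -prodfV; apply: eq_bigr => j _; rewrite invr_expz. Qed.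

Lemma monX s n k : mon s (fun j => n j *+ k) = mon s n ^+ k.
Proof.
by rewrite -prodrXl; apply: eq_bigr => j _; rewrite -mulr_natr natz -exprz_exp.
Qed.

Variables (m : W -> Prop) (L : divringClosed W).
Hypotheses (mP : val_ideal m) (Lm : forall l, l \in L -> l != 0 -> ~ m l).
Hypothesis xm : forall s (n : J -> int), uniq s -> (exists2 j, j \in s & n j != 0) ->
  m (mon s n) \/ m (mon s n)^-1.

(** The group L^x <x_j : j in A> of admissible leading terms. *)
Definition monG (A : J -> Prop) (g : W) := exists l n s,
  [/\ l \in L, l != 0, supp n s, forall j, n j != 0 -> A j & g = l * mon s n].

Lemma monGM A g h : monG A g -> monG A h -> monG A (g * h).
Proof.
move=> [l [n [s [Ll l0 sn An ->]]]] [l' [n' [s' [Ll' l0' sn' An' ->]]]].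
exists (l * l'), (fun j => n j + n' j), (undup (s ++ s')); split.
- by rewrite rpredM.
- by rewrite mulf_neq0.
- by apply: suppD; [exact: supp_catl sn sn' | exact: supp_catr sn sn'].
- move=> j; have [e|/An//] := eqVneq (n j) 0; rewrite e add0r; exact: An'.
- rewrite monD (mon_ext sn (supp_catl sn sn')) (mon_ext sn' (supp_catr sn sn')).
  by rewrite mulrACA.
Qed.

Lemma monGV A g : monG A g -> monG A g^-1.
Proof.
move=> [l [n [s [Ll l0 sn An ->]]]]; exists l^-1, (fun j => - n j), s; split.
- by rewrite rpredV.
- by rewrite invr_eq0.
- exact: suppN.
- by move=> j; rewrite oppr_eq0; exact: An.
- by rewrite monN invfM.
Qed.

Lemma monGS (A B : J -> Prop) g : (forall j, A j -> B j) -> monG A g -> monG B g.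
Proof.
move=> AB [l [n [s [Ll l0 sn An ->]]]]; exists l, n, s; split => // j /An; exact: AB.
Qed.

Lemma mon_total l l' n n' s s' j : l \in L -> l' \in L -> l != 0 -> l' != 0 ->
  supp n s -> supp n' s' -> n j != n' j ->
  vlt m (l * mon s n) (l' * mon s' n') \/ vlt m (l' * mon s' n') (l * mon s n).
Proof.
move=> Ll Ll' l0 l0' sn sn' nj.
pose t := undup (s ++ s'); pose d j := n j - n' j.
have st : supp n t by exact: supp_catl sn sn'.
have st' : supp n' t by exact: supp_catr sn sn'.
have dt : supp d t by apply: suppD => //; exact: suppN.
have ed : mon t d = mon t n / mon t n' by rewrite monD monN.
have [||h|h] := @xm t d; first exact: (proj1 dt).
- by exists j; [apply: (proj2 dt)|]; rewrite /d subr_eq0.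
- left; rewrite (mon_ext sn st) (mon_ext sn' st').
  split; first by rewrite mulf_neq0 ?mon_neq0.
  rewrite -mulf_div -ed mulrC; apply: (valM mP) => //; apply: Lm.
    by rewrite invf_div rpred_div.
  by rewrite invr_eq0 mulf_neq0 ?invr_eq0.
- right; rewrite (mon_ext sn st) (mon_ext sn' st').
  split; first by rewrite mulf_neq0 ?mon_neq0.
  rewrite -mulf_div; move: h; rewrite ed invf_div => h.
  rewrite mulrC; apply: (valM mP) => //; apply: Lm.
    by rewrite invf_div rpred_div.
  by rewrite invr_eq0 mulf_neq0 ?invr_eq0.
Qed.

(** Different exponents would give different values by [mon_total]. With equal exponents (l - l') /
    l' is in L and in m, hence zero. So an element of W has at most one leading term of this
    form. *)
Lemma mon_inj l l' n n' s s' : l \in L -> l' \in L -> l != 0 -> l' != 0 ->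
  supp n s -> supp n' s' -> vsim m (l * mon s n) (l' * mon s' n') ->
  l = l' /\ forall j, n j = n' j.
Proof.
move=> Ll Ll' l0 l0' sn sn' h.
have nn' j : n j = n' j.
  apply/eqP; apply: contraT => nj.
  have [h'|h'] := mon_total Ll Ll' l0 l0' sn sn' nj.
    by case: (vltxx mP (vlt_simr mP h' (vsim_sym mP h))).
  by case: (vltxx mP (vlt_simr mP h' h)).
split=> //; apply/eqP; rewrite -subr_eq0; apply: contraT => d0.
have sn2 : supp n s' by case: sn' => u v; split=> // j; rewrite nn'; exact: v.
have e : mon s n = mon s' n'.
  by rewrite (mon_ext sn sn2); apply: eq_bigr => j _; rewrite nn'.
case: h => _; rewrite e -mulrBl -mulf_div mulfV ?mon_neq0 // mulr1 => h.
have Lh : (l - l') / l' \in L by rewrite rpred_div ?rpredB.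
by case: (Lm Lh) => //; rewrite mulf_neq0 ?invr_eq0.
Qed.

(** In the Horner form f X + c, the leading term of the first summand has positive exponent at j and
    that of c has exponent 0, so the two never cancel. The bound [0 <= n j] carries the
    induction. *)
Lemma monG_lead A k j (f : {poly W}) : dominated m (monG A) k -> ~ A j ->
  f \is a polyOver k -> f != 0 -> exists l n s,
  [/\ [/\ l \in L, l != 0 & supp n s], 0 <= n j,
      forall i, n i != 0 -> A i \/ i = j & vsim m f.[x j] (l * mon s n)].
Proof.
move=> dk nA; elim/poly_ind: f => [|f c IH]; first by rewrite eqxx.
move=> kf f0.
have kc : c \in k by have := polyOverP kf 0%N; rewrite coefD coefMX coefC add0r.
have {}kf : f \is a polyOver k.
  apply/polyOverP => i; have := polyOverP kf i.+1.
  by rewrite coefD coefMX coefC addr0.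
have cP : c != 0 -> exists l n s,
  [/\ [/\ l \in L, l != 0 & supp n s], n j = 0,
      forall i, n i != 0 -> A i \/ i = j & vsim m c (l * mon s n)].
  move=> c0; have [_ [l [n [s [Ll l0 sn An ->]]]] cl] := dk c kc c0.
  exists l, n, s; split=> //; first by apply/eqP; apply: contraT => /An.
  by move=> i /An; left.
rewrite hornerMXaddC; have [e|f0'] := eqVneq f 0.
  have /cP[l [n [s [h1 h2 h3 h4]]]] : c != 0.
    by apply: contraNneq f0 => ->; rewrite e mul0r add0r.
  by exists l, n, s; rewrite e horner0 mul0r add0r h2; split.
have [l [n [s [[Ll l0 sn] nj An fl]]]] := IH kf f0'.
pose n1 i := n i + unitv j i; pose s1 := undup (s ++ [:: j]).
have sn1 : supp n1 s1.
  by apply: suppD; [exact: supp_catl sn (supp_unitv j) | exact: supp_catr sn (supp_unitv j)].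
have e1 : mon s1 n1 = mon s n * x j.
  rewrite monD -(mon_ext sn (supp_catl sn (supp_unitv j))).
  by rewrite -(mon_ext (supp_unitv j) (supp_catr sn (supp_unitv j))) mon_unitv.
have fx : vsim m (f.[x j] * x j) (l * mon s1 n1).
  by rewrite e1 mulrA; apply: vsimM => //; exact: vsim_refl.
have n1j : 0 < n1 j by rewrite /n1 /unitv eqxx; lia.
have An1 i : n1 i != 0 -> A i \/ i = j.
  by rewrite /n1 /unitv; case: (i =P j) => [|_]; [right|rewrite addr0; exact: An].
have [->|/cP[l' [n' [s' [[Ll' l0' sn'] nj' An' cl]]]]] := eqVneq c 0.
  by exists l, n1, s1; split=> //; [lia | rewrite addr0].
have nj1 : n1 j != n' j by rewrite nj'; lia.
have [h|h] := mon_total Ll Ll' l0 l0' sn1 sn' nj1.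
  exists l', n', s'; split=> //; first by rewrite nj'.
  apply: (@vsim_trans _ _ mP c) => //; rewrite addrC; apply: vsim_addr.
  apply: vlt_simr (vsim_sym mP cl) => //; apply: contrapT => n2.
  apply: (vltxx mP (x := l * mon s1 n1)); apply: vlt_simr fx => //.
  exact: vlt_le_trans n2.
exists l, n1, s1; split=> //; first by lia.
apply: (@vsim_trans _ _ mP (f.[x j] * x j)) => //; apply: vsim_addr.
apply: vlt_simr (vsim_sym mP fx) => //; apply: contrapT => n2.
apply: (vltxx mP (x := l' * mon s' n')); apply: vlt_simr cl => //.
exact: vlt_le_trans n2.
Qed.

Lemma monG_transc A k j (f : {poly W}) : dominated m (monG A) k -> ~ A j ->
  f \is a polyOver k -> f != 0 -> f.[x j] != 0.
Proof.
move=> dk nA kf f0; have [l [n [s [_ _ _ h]]]] := monG_lead dk nA kf f0.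
exact: vsim_neq0l h.
Qed.

Lemma dominated_adjoin A j (k k' : divringClosed W) : dominated m (monG A) k -> ~ A j ->
  (forall z, z \in k' <-> adjoins k (x j) z) ->
  dominated m (monG (fun i => A i \/ i = j)) k'.
Proof.
move=> dk nA k'P h /k'P[f [g [kf kg g0 ->]]] h0.
have f0 : f.[x j] != 0 by apply: contraNneq h0 => ->; rewrite mul0r.
have pf : f != 0 by apply: contraNneq f0 => ->; rewrite horner0.
have pg : g != 0 by apply: contraNneq g0 => ->; rewrite horner0.
have [l [n [s [[Ll l0 sn] _ An fl]]]] := monG_lead dk nA kf pf.
have [l' [n' [s' [[Ll' l0' sn'] _ An' gl]]]] := monG_lead dk nA kg pg.
exists ((l * mon s n) / (l' * mon s' n')).
  by apply: monGM; [exists l, n, s | apply: monGV; exists l', n', s'].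
by apply: vsimM => //; exact: vsimV.
Qed.

(** The intended field is L(x_j : j in A). In [Q] the leading terms may use only those x_i that
    already belong to the field, so a missing x_j is covered by [dominated_adjoin], which
    contradicts maximality. *)
Lemma monomial_field A : exists k : divringClosed W,
  [/\ {subset L <= k}, forall j, A j -> x j \in k & dominated m (monG A) k].
Proof.
pose Q (k : divringClosed W) :=
  {subset L <= k} /\ dominated m (monG (fun i => A i /\ x i \in k)) k.
have [||k [_ [Lk dk] maxk]] := @subfield_Zorn W Q L.
- split=> // l Ll l0; exists l; last exact: vsim_refl.
  exists l, (fun=> 0), [::]; rewrite /mon big_nil mulr1; split=> //.
- move=> C [F0 CF0] CQ _ U UP; split.
    by move=> l Ll; apply/UP; exists F0 => //; apply: (CQ _ CF0).1.
  move=> h /UP[F CF Fh] h0; have [g Gg hg] := (CQ _ CF).2 h Fh h0.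
  exists g => //; apply: monGS Gg => i [Ai Fi]; split=> //.
  by apply/UP; exists F.
have xk j : A j -> x j \in k.
  move=> Aj; apply: contraT => nk; have [k' k'P] := adjoin_ex k (x j).
  suff : x j \in k by rewrite (negPf nk).
  apply: (maxk k'); last exact/k'P/adjoins_gen.
    by move=> z kz; apply/k'P/adjoins_base.
  have kk' z : z \in k -> z \in k' by move=> kz; apply/k'P/adjoins_base.
  split=> [l /Lk /kk' //|].
  move=> h Hh h0; have nA : ~ (A j /\ x j \in k) by move=> [_]; apply/negP.
  have [g Gg hg] := dominated_adjoin dk nA k'P Hh h0.
  exists g => //; apply: monGS Gg => i [[Ai /kk' //]|->].
  by split=> //; apply/k'P/adjoins_gen.
exists k; split=> // h kh h0; have [g Gg hg] := dk h kh h0.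
by exists g => //; apply: monGS Gg => i [].
Qed.

End Monomials.

Lemma mup_exp (W : fieldType) (a : W) (f : {poly W}) n : f != 0 ->
  mup a (f ^+ n) = (n * mup a f)%N.
Proof.
move=> f0; elim: n => [|n IH]; first by rewrite expr0 mupNroot // root1.
by rewrite exprS mupM ?expf_neq0 // IH mulSn.
Qed.

(** As x0 is transcendental over k, a relation is an identity P g^p = f^p between polynomials.
    Comparing multiplicities at the root d(s j) makes its exponent in P divisible by p. *)
Lemma pindep_linear (W : fieldType) (p : nat) (k k1 : divringClosed W) (x0 : W)
    (E : Type) (d : E -> W) : (0 < p)%N ->
  (forall f, f \is a polyOver k -> f != 0 -> f.[x0] != 0) ->
  (forall z, z \in k1 <-> adjoins k x0 z) ->
  (forall i, d i \in k) -> injective d ->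
  pindep p (fun i => d i - x0) k1.
Proof.
move=> p_gt0 tr k1P kd inj_d n s r w inj_s /k1P[f [g [kf kg g0 ->]]] e j.
pose P := \prod_(i < n) ((d (s i))%:P - 'X) ^+ r i.
have kP : P \is a polyOver k.
  by apply: rpred_prod => i _; rewrite rpredX // rpredB ?polyOverX // polyOverC.
have pg : g != 0 by apply: contraNneq g0 => ->; rewrite horner0.
have lin0 i : (d (s i))%:P - 'X != 0.
  by rewrite -opprB oppr_eq0 polyXsubC_eq0.
have P0 : P != 0 by rewrite prodf_seq_neq0; apply/allP => i _; rewrite expf_neq0.
have eP : P * g ^+ p = f ^+ p.
  apply/eqP; rewrite -subr_eq0; apply: contraT => D0.
  have kD : P * g ^+ p - f ^+ p \is a polyOver k by rewrite rpredB ?rpredM ?rpredX.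
  have := tr _ kD D0.
  rewrite !hornerE horner_prod.
  under eq_bigr do rewrite !hornerE.
  by rewrite e expr_div_n divfK ?expf_neq0 // subrr eqxx.
have f0 : f != 0.
  have : f ^+ p != 0 by rewrite -eP mulf_neq0 // expf_neq0.
  by apply: contraNneq => ->; rewrite expr0n gtn_eqF.
have := congr1 (mup (d (s j))) eP.
rewrite mupM ?expf_neq0 // !mup_exp // /P (bigD1 j) //=.
rewrite mupMl; last first.
  rewrite rootE horner_prod prodf_seq_neq0; apply/allP => i _; apply/implyP => ij.
  rewrite !hornerE expf_neq0 // subr_eq0; apply: contraNneq ij.
  by move=> /inj_d/inj_s ->.
rewrite -opprB -mulN1r exprMn mupMr; last first.
  by rewrite -polyCN -rmorphXn rootC signr_eq0.
rewrite (mup_XsubCX) eqxx => h.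
have -> : r j = (p * mup (d (s j)) f - p * mup (d (s j)) g)%N by lia.
by rewrite dvdn_sub ?dvdn_mulr.
Qed.

(** * Ultrapowers *)

Section Ultrapower.
Local Open Scope classical_set_scope.
Local Open Scope ring_scope.
Variables (C : closedFieldType) (S : Type) (U : set_system S).
Hypothesis UU : UltraFilter U.

Definition ultra_eq (f g : S -> C) : bool := `[< U [set s | f s = g s] >].

Fact ultra_eq_equiv : equiv_class_of ultra_eq.
Proof.
split=> [f|f g|g f h].
- by apply/asboolP; apply: filterE.
- by apply/asboolP/asboolP; apply: filterS => s.
- by move=> /asboolP fg /asboolP gh; apply/asboolP; apply: filterS2 fg gh => s /= ->.
Qed.

Canonical ultra_eq_equivrel := EquivRelPack ultra_eq_equiv.

Definition upow := {eq_quot ultra_eq}%qT.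
HB.instance Definition _ := Choice.on upow.

Definition cls (f : S -> C) : upow := \pi_upow%qT f.
Definition rep (x : upow) : S -> C := repr x.

Lemma clsP f g : cls f = cls g <-> U [set s | f s = g s].
Proof.
split=> [/eqmodP/asboolP//|h]; apply/eqmodP.
exact/asboolP.
Qed.

Lemma repK x : cls (rep x) = x. Proof. exact: reprK. Qed.

Lemma rep_cls f : U [set s | rep (cls f) s = f s].
Proof. by apply/clsP; rewrite repK. Qed.

Definition ulift1 (o : C -> C) x := cls (fun s => o (rep x s)).
Definition ulift2 (o : C -> C -> C) x y := cls (fun s => o (rep x s) (rep y s)).

Lemma ulift1E o f : ulift1 o (cls f) = cls (fun s => o (f s)).
Proof. by apply/clsP; apply: filterS (rep_cls f) => s /= ->. Qed.

Lemma ulift2E o f g : ulift2 o (cls f) (cls g) = cls (fun s => o (f s) (g s)).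
Proof. by apply/clsP; apply: filterS2 (rep_cls f) (rep_cls g) => s /= -> ->. Qed.

Lemma cls_ind (P : upow -> Prop) : (forall f, P (cls f)) -> forall x, P x.
Proof. by move=> h x; rewrite -(repK x). Qed.

Lemma cls_ext f g : f =1 g -> cls f = cls g.
Proof. by move=> /funext ->. Qed.

Fact upow_addA : associative (ulift2 +%R).
Proof.
elim/cls_ind=> f; elim/cls_ind=> g; elim/cls_ind=> h; rewrite !ulift2E.
by apply: cls_ext => s; rewrite addrA.
Qed.
Fact upow_addC : commutative (ulift2 +%R).
Proof.
by elim/cls_ind=> f; elim/cls_ind=> g; rewrite !ulift2E; apply: cls_ext => s; rewrite addrC.
Qed.
Fact upow_add0 : left_id (cls (fun=> 0)) (ulift2 +%R).
Proof. by elim/cls_ind=> f; rewrite !ulift2E; apply: cls_ext => s; rewrite add0r. Qed.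
Fact upow_addN : left_inverse (cls (fun=> 0)) (ulift1 -%R) (ulift2 +%R).
Proof.
by elim/cls_ind=> f; rewrite ulift1E !ulift2E; apply: cls_ext => s; rewrite addNr.
Qed.
HB.instance Definition _ := GRing.isZmodule.Build upow upow_addA upow_addC upow_add0 upow_addN.

Fact upow_mulA : associative (ulift2 *%R).
Proof.
elim/cls_ind=> f; elim/cls_ind=> g; elim/cls_ind=> h; rewrite !ulift2E.
by apply: cls_ext => s; rewrite mulrA.
Qed.
Fact upow_mulC : commutative (ulift2 *%R).
Proof.
by elim/cls_ind=> f; elim/cls_ind=> g; rewrite !ulift2E; apply: cls_ext => s; rewrite mulrC.
Qed.
Fact upow_mul1 : left_id (cls (fun=> 1)) (ulift2 *%R).
Proof. by elim/cls_ind=> f; rewrite !ulift2E; apply: cls_ext => s; rewrite mul1r. Qed.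
Fact upow_mulDl : left_distributive (ulift2 *%R) +%R.
Proof.
elim/cls_ind=> f; elim/cls_ind=> g; elim/cls_ind=> h.
by rewrite /GRing.add /= !ulift2E; apply: cls_ext => s; rewrite mulrDl.
Qed.
Fact upow_one_neq0 : cls (fun=> 1) != 0.
Proof.
apply/eqP => /clsP h; have [s /= /eqP] := filter_ex h.
by rewrite oner_eq0.
Qed.
HB.instance Definition _ := GRing.Zmodule_isComNzRing.Build upow
  upow_mulA upow_mulC upow_mul1 upow_mulDl upow_one_neq0.

Lemma clsD f g : cls (fun s => f s + g s) = cls f + cls g.
Proof. by rewrite -ulift2E. Qed.
Lemma clsN f : cls (fun s => - f s) = - cls f.
Proof. by rewrite -ulift1E. Qed.
Lemma clsM f g : cls (fun s => f s * g s) = cls f * cls g.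
Proof. by rewrite -ulift2E. Qed.
Lemma cls0 : cls (fun=> 0) = 0. Proof. by []. Qed.
Lemma cls1 : cls (fun=> 1) = 1. Proof. by []. Qed.

Lemma cls_neq0 f : cls f != 0 <-> U [set s | f s != 0].
Proof.
split=> [h|h].
  have [h0|] := in_ultra_setVsetC [set s | f s = 0] UU.
    by case/eqP: h; apply/clsP.
  by apply: filterS => s /= /eqP.
apply/eqP => /clsP h0; have [s /= [/eqP]] := filter_ex (filterI h h0).
by [].
Qed.

Fact upow_mulV : forall x : upow, x != 0 -> ulift1 GRing.inv x * x = 1.
Proof.
elim/cls_ind=> f /cls_neq0 f0; rewrite ulift1E -clsM -cls1; apply/clsP.
by apply: filterS f0 => s /= f0; rewrite mulVf.
Qed.
Fact upow_inv0 : ulift1 GRing.inv 0 = 0.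
Proof. by rewrite -cls0 ulift1E invr0. Qed.
HB.instance Definition _ := GRing.ComNzRing_isField.Build upow upow_mulV upow_inv0.

Lemma clsV f : cls (fun s => (f s)^-1) = (cls f)^-1.
Proof. by rewrite -ulift1E. Qed.
Lemma clsX f n : cls (fun s => f s ^+ n) = cls f ^+ n.
Proof.
elim: n => [|n IH]; first by rewrite [RHS]expr0 -cls1.
by rewrite exprS -IH -clsM; apply: cls_ext => s; rewrite exprS.
Qed.
Lemma clsXz f (n : int) : cls (fun s => f s ^ n) = cls f ^ n.
Proof.
case: n => n; first exact: clsX.
by transitivity ((cls f ^+ n.+1)^-1); first by rewrite -clsX -clsV.
Qed.
Lemma cls_sum I (r : seq I) (f : I -> S -> C) :
  cls (fun s => \sum_(i <- r) f i s) = \sum_(i <- r) cls (f i).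
Proof.
elim: r => [|i r IH]; first by rewrite big_nil -cls0; apply: cls_ext => s; rewrite big_nil.
by rewrite big_cons -IH -clsD; apply: cls_ext => s; rewrite big_cons.
Qed.
Lemma cls_prod I (r : seq I) (f : I -> S -> C) :
  cls (fun s => \prod_(i <- r) f i s) = \prod_(i <- r) cls (f i).
Proof.
elim: r => [|i r IH]; first by rewrite big_nil -cls1; apply: cls_ext => s; rewrite big_nil.
by rewrite big_cons -IH -clsM; apply: cls_ext => s; rewrite big_cons.
Qed.

Fact upow_closed : GRing.closed_field_axiom upow.
Proof.
move=> n P n_gt0.
have /choice[f fP] : forall s, exists x : C, x ^+ n = \sum_(i < n) rep (P i) s * x ^+ i.
  by move=> s; exact: (@solve_monicpoly C n (fun i => rep (P i) s) n_gt0).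
exists (cls f); rewrite -clsX.
under eq_bigr => i _ do rewrite -(repK (P i)) -clsX -clsM.
by rewrite -cls_sum; apply: cls_ext.
Qed.
HB.instance Definition _ := Field_isAlgClosed.Build upow upow_closed.

Definition ucst (a : C) : upow := cls (fun=> a).
Fact ucst_zmod : zmod_morphism ucst.
Proof. by move=> a b; rewrite /ucst -clsN -clsD. Qed.
Fact ucst_monoid : monoid_morphism ucst.
Proof. by split=> // a b; rewrite /ucst -clsM. Qed.
HB.instance Definition _ := GRing.isZmodMorphism.Build C upow ucst ucst_zmod.
HB.instance Definition _ := GRing.isMonoidMorphism.Build C upow ucst ucst_monoid.

Lemma ultra_finite n (g : S -> nat) : (forall s, (g s < n)%N) ->
  exists2 i, (i < n)%N & U [set s | g s = i].
Proof.
elim: n g => [|n IH] g gn; first by have [s] := filter_ex (@filterT _ U _); have := gn s.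
have [h|h] := in_ultra_setVsetC [set s | g s = n] UU; first by exists n.
have [s0 h0] := filter_ex h.
have n0 : (0 < n)%N by have := gn s0; move/eqP: h0; lia.
(* The induction hypothesis wants a bound at every s, so g is truncated; nothing changes on the set
   where g s differs from n. *)
have [|i ip Ui] := IH (fun s => minn (g s) n.-1); first by move=> s; lia.
exists i; first by lia.
apply: filterS2 h Ui => s /= /eqP h1 h2; have := gn s; lia.
Qed.

End Ultrapower.

(** * A valued field of large rank *)

Section Model.
Local Open Scope classical_set_scope.
Local Open Scope ring_scope.
Variables (E J : eqType).

(* An ultrafilter on uindex will make iE and iJ contain any given finite set, iN
   exceed any integer and iR exceed any function of iE.  Then the elements x_j
   of value iR ^ (iN ^ k), with k the position of j in iJ, have the property
   that a nontrivial monomial in them is infinite or infinitesimal with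
   respect to the functions of iE. *)
Record uindex := UIndex { iE : seq E; iJ : seq J; iR : nat; iN : nat }.

Definition index_filter : set_system uindex := [set A |
  exists (l0 : seq E) (m0 : seq J) N0 (f : seq E -> algC), forall s,
    {subset l0 <= iE s} -> {subset m0 <= iJ s} -> (N0 <= iN s)%N ->
    `|f (iE s)| <= (iR s)%:R -> A s].

Lemma index_filter_proper : ProperFilter index_filter.
Proof.
apply: Build_ProperFilter_ex.
  move=> A [l0 [m0 [N0 [f h]]]].
  (* The component [iR] is chosen last, since its bound depends on the chosen [iE]. *)
  exists (UIndex l0 m0 (Num.bound `|f l0|) N0); apply: h => //=.
  by apply: ltW; apply: archi_boundP.
split.
- by exists [::], [::], 0%N, (fun=> 0).
- move=> A B [l0 [m0 [N0 [f h]]]] [l1 [m1 [N1 [g h']]]].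
  exists (l0 ++ l1), (m0 ++ m1), (N0 + N1)%N, (fun l => `|f l| + `|g l|).
  move=> s hl hm hN; rewrite ger0_norm ?addr_ge0 // => hf.
  split; [apply: h | apply: h'].
  + by move=> i il; apply: hl; rewrite mem_cat il.
  + by move=> i il; apply: hm; rewrite mem_cat il.
  + exact: leq_trans (leq_addr _ _) hN.
  + by apply: le_trans hf; rewrite lerDl.
  + by move=> i il; apply: hl; rewrite mem_cat il orbT.
  + by move=> i il; apply: hm; rewrite mem_cat il orbT.
  + exact: leq_trans (leq_addl _ _) hN.
  + by apply: le_trans hf; rewrite lerDr.
- move=> A B AB [l0 [m0 [N0 [f h]]]]; exists l0, m0, N0, f => s h1 h2 h3 h4.
  by apply: AB; apply: h.
Qed.

Section Ultra.
Variable U : set_system uindex.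
Hypotheses (UU : UltraFilter U) (FU : index_filter `<=` U).

Lemma U_E (l0 : seq E) : U [set s | {subset l0 <= iE s}].
Proof. by apply: FU; exists l0, [::], 0%N, (fun=> 0). Qed.
Lemma U_J (m0 : seq J) : U [set s | {subset m0 <= iJ s}].
Proof. by apply: FU; exists [::], m0, 0%N, (fun=> 0). Qed.
Lemma U_N N0 : U [set s | (N0 <= iN s)%N].
Proof. by apply: FU; exists [::], [::], N0, (fun=> 0). Qed.
Lemma U_R (f : seq E -> algC) : U [set s | `|f (iE s)| <= (iR s)%:R].
Proof. by apply: FU; exists [::], [::], 0%N, f. Qed.

Local Notation W := (upow algC UU).

(** The classes below the inverse of every function of [iE]. Since f can be rescaled, the bound 1 is
    as good as any smaller one. *)
Definition infinitesimal (z : W) := forall f : seq E -> algC,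
  U [set s | `|f (iE s) * rep z s| <= 1].

Lemma infP h : infinitesimal (cls UU h) <->
  forall f : seq E -> algC, U [set s | `|f (iE s) * h s| <= 1].
Proof.
split=> H f; apply: filterS2 (H f) (rep_cls UU h) => s /= h1 h2.
  by rewrite -h2.
by rewrite h2.
Qed.

Lemma U_false (A : set uindex) : U A -> (forall s, ~ A s) -> False.
Proof. by move=> /filter_ex[s As] h; exact: (h s). Qed.

Lemma U_I (A B : set uindex) : U A -> U B -> U (A `&` B).
Proof. exact: filterI. Qed.

Lemma norm_ge1 (a : algC) : (`|a| <= 1) = false -> 1 < `|a|.
Proof. by move=> h; rewrite real_ltNge ?rpred1 ?normr_real // h. Qed.

(** The valuation ring consists of the classes bounded by some function of [iE]: if y^-1 is not
    infinitesimal, the ultrafilter provides f0 with |y| <= |f0| almost everywhere. Such bounds can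
    be multiplied into the test function, and a factor 2 in the test functions gives the strictness
    needed for sums and units. *)
Lemma infinitesimal_val : val_ideal infinitesimal.
Proof.
split.
- by rewrite -(cls0 algC UU); apply/infP => f; apply: filterE => s /=; rewrite mulr0 normr0 ler01.
- rewrite -(cls1 algC UU) => /infP /(_ (fun=> 2)) /U_false; apply=> s /=.
  by rewrite mulr1 normr_nat lern1.
- elim/cls_ind=> g; elim/cls_ind=> h /infP gi /infP hi; rewrite -clsD; apply/infP => f.
  apply: filterS2 (gi (fun l => 2 * f l)) (hi (fun l => 2 * f l)) => s /=.
  rewrite -!mulrA !normrM !normr_nat => h1 h2.
  rewrite -(ler_pM2l (ltr0n _ 2)) mulr1.
  apply: (@le_trans _ _ (2 * (`|f (iE s)| * `|g s|) + 2 * (`|f (iE s)| * `|h s|))).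
    by rewrite -mulrDr ler_pM2l ?ltr0n // -mulrDr ler_wpM2l // ler_normD.
  by rewrite -[X in _ <= X]/(1 + 1); apply: lerD.
- elim/cls_ind=> g; elim/cls_ind=> h /infP gi; rewrite -clsV => /infP.
  move=> /existsNP[f0 nf0]; rewrite -clsM; apply/infP => f.
  have [//|nf] := in_ultra_setVsetC [set s | `|f0 (iE s) / h s| <= 1] UU.
  apply: filterS2 nf (gi (fun l => f l * f0 l)) => s /= /negP/negPf /norm_ge1 h1 h2.
  have h0 : h s != 0.
    by apply: contraTneq h1 => ->; rewrite invr0 mulr0 normr0 ltr10.
  have hf0 : `|h s| <= `|f0 (iE s)|.
    by move: h1; rewrite normrM normfV ltr_pdivlMr ?normr_gt0 // mul1r => /ltW.
  apply: le_trans h2; rewrite mulrA [f _ * f0 _ * _]mulrAC !normrM.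
  by rewrite ler_wpM2l // mulr_ge0.
- elim/cls_ind=> g /infP gi /cls_neq0 g0; rewrite -clsV => /infP hi.
  have hU := U_I (U_I g0 (gi (fun=> 2))) (hi (fun=> 2)).
  apply: (U_false hU) => s /= [[g0' h1] h2].
  have : `|2 * g s| * `|2 / g s| <= 1 by rewrite mulr_ile1.
  by rewrite -normrM mulrACA mulfV // mulr1 -natrM normr_nat lern1.
Qed.

Definition iscale (f : seq E -> algC) : W := cls UU (fun s => f (iE s)).

Variable L1 : divringClosed algC.

(** All functions of [iE] with values in L1 are taken, not only constants: this makes room for a
    family indexed by E, while properties of L1 can still be checked pointwise. *)
Lemma residue_field : exists L : divringClosed W,
  forall z, z \in L <-> exists2 f : seq E -> algC, (forall l, f l \in L1) & z = iscale f.
Proof.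
apply: mk_subfield.
- by exists (fun=> 1) => // l; rewrite rpred1.
- move=> _ _ [f hf ->] [g hg ->]; exists (fun l => f l - g l) => [l|].
    by rewrite rpredB.
  by rewrite /iscale -clsN -clsD.
- move=> _ _ [f hf ->] [g hg ->]; exists (fun l => f l / g l) => [l|].
    by rewrite rpred_div.
  by rewrite /iscale -clsV -clsM.
Qed.

Lemma iscale_unit f : iscale f != 0 -> ~ infinitesimal (iscale f).
Proof.
move=> /cls_neq0 f0 /infP /(_ (fun l => 2 / f l)) h.
apply: (U_false (U_I f0 h)) => s /= [f0' ].
by rewrite divfK // normr_nat lern1.
Qed.

Definition ix (j : J) : W := cls UU (fun s => (iR s)%:R ^+ (iN s ^ index j (iJ s))).

Lemma U_R2 : U [set s | (1 < iR s)%N].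
Proof. by apply: filterS (U_R (fun=> 2)) => s /=; rewrite normr_nat ler_nat. Qed.

Lemma ix_neq0 j : ix j != 0.
Proof.
apply/cls_neq0; apply: filterS U_R2 => s /= h.
by rewrite expf_neq0 // pnatr_eq0 -lt0n ltnW.
Qed.

(** Let i be the least position with a nonzero exponent n_j. All other terms are divisible by
    N^(i+1), so a zero sum would make N divide n_j, against 0 < |n_j| < N. *)
Lemma expo_neq0 (s : uindex) (t : seq J) (n : J -> int) j0 : uniq t ->
  j0 \in t -> n j0 != 0 -> {subset t <= iJ s} ->
  (forall j, j \in t -> (`|n j| < iN s)%N) ->
  \sum_(j <- t) (iN s ^ index j (iJ s))%:Z * n j != 0.
Proof.
move=> ut j0t nj0 ts hN.
pose P i := has (fun j => (n j != 0) && (index j (iJ s) == i)) t.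
have exP : exists i, P i.
  by exists (index j0 (iJ s)); apply/hasP; exists j0 => //; rewrite nj0 eqxx.
have [i /hasP[j jt /andP[nj /eqP ij]] mini] := ex_minnP exP.
apply: contraTneq (hN j jt) => e0; rewrite -leqNgt.
apply: dvdn_leq; first by rewrite absz_gt0.
have N0 : (0 < iN s)%N by apply: leq_trans (hN j jt).
have : ((iN s ^ i.+1)%:Z %| (iN s ^ i)%:Z * n j)%Z.
  have : ((iN s ^ i.+1)%:Z %| \sum_(j <- t) (iN s ^ index j (iJ s))%:Z * n j)%Z by rewrite e0 dvdz0.
  rewrite (bigD1_seq j) //= ij rpredDr // big_seq_cond.
  apply: rpred_sum => k /andP[kt kj]; have [->|nk] := eqVneq (n k) 0.
    by rewrite mulr0 rpred0.
  apply: dvdz_mulr; rewrite dvdzE /= dvdn_exp2l // ltn_neqAle.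
  rewrite mini ?andbT; last by apply/hasP; exists k => //; rewrite nk eqxx.
  rewrite -ij; apply: contraNneq kj => e; apply/eqP.
  by rewrite -(nth_index j (ts k kt)) -e nth_index // ts.
by rewrite dvdzE abszM /= expnSr dvdn_pmul2l // expn_gt0 N0.
Qed.

(** Almost everywhere the monomial is a power of R with nonzero integral exponent, of constant sign
    on a set of the ultrafilter. A negative power is at most 1/R, and R exceeds every function of
    [iE]. *)
Lemma ix_mon (t : seq J) (n : J -> int) : uniq t -> (exists2 j, j \in t & n j != 0) ->
  infinitesimal (mon ix t n) \/ infinitesimal (mon ix t n)^-1.
Proof.
move=> ut [j0 j0t nj0].
pose e s := \sum_(j <- t) (iN s ^ index j (iJ s))%:Z * n j.
have monE : mon ix t n = cls UU (fun s => (iR s)%:R ^ e s).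
  rewrite /mon /ix; under eq_bigr => j _ do rewrite -clsXz.
  rewrite -cls_prod; apply/clsP; apply: filterS U_R2 => s /= R2.
  have R0 : (iR s)%:R != 0 :> algC by rewrite pnatr_eq0 -lt0n ltnW.
  rewrite /e; elim: (t) => [|j t' IH]; first by rewrite !big_nil expr0z.
  by rewrite !big_cons expfzDr // -IH -exprz_exp.
have e0 : U [set s | e s != 0].
  pose N0 := \sum_(j <- t) `|n j|%N.
  apply: filterS2 (U_J t) (U_N N0.+1) => s /= ts Ns.
  apply: (@expo_neq0 s t n j0) => // j jt; apply: leq_trans Ns; rewrite ltnS.
  by rewrite /N0 (bigD1_seq j) //= leq_addr.
have small (f : seq E -> algC) (g : uindex -> int) : U [set s | g s < 0] ->
    U [set s | `|f (iE s) * (iR s)%:R ^ g s| <= 1].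
  move=> g0; apply: filterS2 (U_I g0 U_R2) (U_R f) => s /= [gs R2] fR.
  have R0 : 0 < (iR s)%:R :> algC by rewrite ltr0n ltnW.
  rewrite normrM; apply: (@le_trans _ _ ((iR s)%:R * (iR s)%:R ^ (-1))); last first.
    by rewrite exprN1 mulfV // gt_eqF.
  have Rg0 : 0 <= (iR s)%:R ^ g s :> algC by rewrite exprz_ge0 // ltW.
  rewrite (ger0_norm Rg0); apply: ler_pM => //.
  case: (g s) gs => // k _; rewrite exprN1 -[_ ^ _]/((iR s)%:R ^- k.+1).
  by rewrite lef_pV2 ?posrE ?exprn_gt0 // ler_eXnr // ler1n ltnW.
have [neg|pos] := in_ultra_setVsetC [set s | e s < 0] UU.
  by left; rewrite monE; apply/infP => f; apply: small.
right; rewrite monE -clsV; apply/infP => f.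
have : U [set s | - e s < 0].
  by apply: filterS2 pos e0 => s /=; lia.
by move=> /(small f); apply: filterS => s /=; rewrite -invr_expz.
Qed.

(** The position of i in the list, shifted by one to be nonzero. Positive integers belong to every
    L1 and are determined by their p-th powers. *)
Definition ic (i : E) : W := iscale (fun l => (index i l).+1%:R).

Lemma ic_pow_inj (p : nat) i i' : (0 < p)%N -> ic i ^+ p = ic i' ^+ p -> i = i'.
Proof.
move=> p0; rewrite /ic /iscale -!clsX => /clsP h.
have [s /= [sub]] := filter_ex (U_I (U_E [:: i; i']) h).
move/eqP; rewrite -!natrX eqr_nat eqn_exp2r // eqSS => /eqP e.
have il : i \in iE s by apply: sub; rewrite mem_head.
have il' : i' \in iE s by apply: sub; rewrite !inE eqxx orbT.
by rewrite -(nth_index i il) e nth_index.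
Qed.

Lemma ic_neq0 i : ic i != 0.
Proof. by apply/cls_neq0; apply: filterE => s /=; rewrite pnatr_eq0. Qed.

End Ultra.
End Model.

(* W is an ultrapower of algC, and io its diagonal embedding.  The field L consists
   of the classes of the functions of iE with values in L1. *)
Lemma valued_field_ex (E J : eqType) (L1 : divringClosed algC) :
  exists (W : closedFieldType) (io : {rmorphism algC -> W}) (m : W -> Prop)
    (L : divringClosed W) (x : J -> W) (c : E -> W),
  [/\ [/\ val_ideal m, forall l, l \in L -> l != 0 -> ~ m l,
      forall j, x j != 0 &
      forall s (n : J -> int), uniq s -> (exists2 j, j \in s & n j != 0) ->
        m (mon x s n) \/ m (mon x s n)^-1],
    [/\ forall a, a \in L1 -> io a \in L, forall i, c i \in L, forall i, c i != 0 &
      forall p i i', (0 < p)%N -> c i ^+ p = c i' ^+ p -> i = i'] &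
    [/\ forall p xi, (forall z, z \in L1 -> z != 0 -> exists2 k, (k < p)%N &
           exists2 y, y \in L1 & z = xi ^+ k * y ^+ p) ->
         forall z, z \in L -> z != 0 -> exists k : nat,
           exists2 y, y \in L & z = io xi ^+ k * y ^+ p,
       forall p a y, y \in L -> y ^+ p = io a -> exists2 y1, y1 \in L1 & y1 ^+ p = a &
       (forall z, z \in L1 -> exists2 y, y \in L1 & z ^+ 2 + 1 = y ^+ 2) ->
         forall z, z \in L -> exists2 y, y \in L & z ^+ 2 + 1 = y ^+ 2]].
Proof.
have [U [UU FU]] := ultraFilterLemma (index_filter_proper E J).
have [L LP] := residue_field UU L1.
have natL1 n : n%:R \in L1 by rewrite rpred_nat.
exists (upow algC UU : closedFieldType), (@ucst algC _ _ UU : {rmorphism _ -> _}).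
exists (@infinitesimal E J U UU), L, (ix UU), (ic UU); split; split.
- exact: infinitesimal_val.
- by move=> _ /LP[f _ ->]; exact: iscale_unit.
- exact: ix_neq0.
- exact: ix_mon.
- by move=> a La; apply/LP; exists (fun=> a).
- by move=> i; apply/LP; exists (fun l => (index i l).+1%:R).
- exact: ic_neq0.
- exact: ic_pow_inj.
- move=> p xi H _ /LP[f Lf ->] /cls_neq0 f0.
  have /choice[k kP] : forall l, exists ky : nat * algC,
      f l != 0 -> [/\ (ky.1 < p)%N, ky.2 \in L1 & f l = xi ^+ ky.1 * ky.2 ^+ p].
    move=> l; have [e|n] := eqVneq (f l) 0; first by exists (0%N, 0).
    by have [k kp [y Ly e]] := H _ (Lf l) n; exists (k, y).
  have [s0 /= n0] := filter_ex f0.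
  have p0 : (0 < p)%N by case: (kP _ n0) => h _ _; apply: leq_trans h.
  (* The exponent of xi varies with the list; being bounded by p, it is constant on a set of the
     ultrafilter. The truncation deals with lists where f vanishes and the chosen exponent is
     arbitrary. *)
  have [|i ip Ui] := @ultra_finite _ U UU p (fun s => minn (k (iE s)).1 p.-1).
    by move=> s; lia.
  pose y l := if f l != 0 then (k l).2 else 0.
  exists i, (iscale UU y).
    apply/LP; exists y => // l; rewrite /y; case: ifP => [/kP[]//|_].
    by rewrite rpred0.
  rewrite /iscale /= /ucst -!clsX -clsM; apply/clsP.
  apply: filterS2 f0 Ui => s /= fs; have [h1 h2 h3] := kP _ fs.
  move=> e; rewrite /y fs {1}h3; congr (_ ^+ _ * _); lia.
- move=> p a _ /LP[f Lf ->]; rewrite /iscale /= /ucst -clsX => /clsP h.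
  by have [s /= e] := filter_ex h; exists (f (iE s)).
- move=> H _ /LP[f Lf ->].
  have /choice[y yP] : forall l, exists y, y \in L1 /\ f l ^+ 2 + 1 = y ^+ 2.
    by move=> l; have [y] := H _ (Lf l); exists y.
  exists (iscale UU y); first by apply/LP; exists y => // l; case: (yP l).
  rewrite /iscale -!clsX -(cls1 algC UU) -clsD; apply: cls_ext => s.
  by case: (yP (iE s)).
Qed.

(** * Kummer extensions *)

Section KummerExtension.
Variables (F W : fieldType) (iota : {rmorphism F -> W}) (p : nat) (xi a : F) (alpha : W).
Hypotheses (p_pr : prime p) (xiP : p.-primitive_root xi).
Hypotheses (a_npow : forall y : F, y ^+ p <> a) (alphaP : alpha ^+ p = iota a).

Let p_gt0 : (0 < p)%N := prime_gt0 p_pr.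
Let P : {poly F} := 'X^p - a%:P.

Let iotaxiP : p.-primitive_root (iota xi).
Proof. by rewrite fmorph_primitive_root. Qed.

Let map_P (K : fieldType) (f : {rmorphism F -> K}) : map_poly f P = 'X^p - (f a)%:P.
Proof. by rewrite rmorphB /= map_polyXn map_polyC. Qed.

Lemma Kummer_poly_root : root (map_poly iota P) alpha.
Proof. by rewrite map_P rootE !hornerE alphaP subrr. Qed.

Lemma Kummer_poly_neq0 : P != 0.
Proof. by rewrite monic_neq0 ?monicXnsubC. Qed.

(** Irreducibility is tested in W, where [Kummer_minpoly] applies to the image of F and to alpha. *)
Lemma Kummer_poly_irr : irreducible_poly P.
Proof.
apply/(subfx_irreducibleP Kummer_poly_root Kummer_poly_neq0) => q qr q0.
have [|||I IP] := @mk_subfield W (fun w => exists y, w = iota y).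
- by exists 1; rewrite rmorph1.
- by move=> _ _ [y ->] [y' ->]; exists (y - y'); rewrite rmorphB.
- by move=> _ _ [y ->] [y' ->]; exists (y / y'); rewrite fmorph_div.
have Ixi : iota xi \in I by apply/IP; exists xi.
have Ia : alpha ^+ p \in I by rewrite alphaP; apply/IP; exists a.
have Ial : alpha \notin I.
  apply/negP => /IP[y ey]; apply: (a_npow (y := y)); apply: (fmorph_inj iota).
  by rewrite rmorphXn -alphaP ey.
have [_ _ _ minp] := Kummer_minpoly p_pr iotaxiP Ixi Ia Ial.
rewrite -(size_map_poly iota q) size_XnsubC //.
have := minp (map_poly iota q); rewrite size_XnsubC //; apply => //.
- by apply/polyOverP => i; rewrite coef_map; apply/IP; eexists.
- by rewrite map_poly_eq0.
Qed.

Let K0 : fieldExtType F := SubFieldExtType Kummer_poly_root Kummer_poly_irr.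
Let j0 : {rmorphism K0 -> W} := subfx_inj.
Let z0 : K0 := subfx_root iota alpha P.

Let j0z : j0 z0 = alpha.
Proof. exact: (subfx_inj_root Kummer_poly_root Kummer_poly_neq0). Qed.

Let j0A c : j0 c%:A = iota c.
Proof. exact: (subfx_inj_base Kummer_poly_root Kummer_poly_neq0). Qed.

Let z0p : z0 ^+ p = a%:A.
Proof. by apply: (fmorph_inj j0); rewrite rmorphXn /= j0z j0A alphaP. Qed.

Let z0E (w : K0) : exists q : {poly F}, (size q <= p)%N /\ w = (map_poly (in_alg K0) q).[z0].
Proof.
have [q ->] := subfxEroot Kummer_poly_root Kummer_poly_neq0 w.
exists (q %% P); split.
  have := ltn_modpN0 q Kummer_poly_neq0; rewrite size_XnsubC //.
rewrite [in LHS](divp_eq q P) rmorphD rmorphM /= hornerD hornerM.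
rewrite (_ : (map_poly (in_alg K0) P).[z0] = 0) ?mulr0 ?add0r //.
by rewrite map_P !hornerE z0p /= subrr.
Qed.

Let xi0P : p.-primitive_root (xi%:A : K0).
Proof. by rewrite -in_algE fmorph_primitive_root. Qed.

Let z00 : z0 != 0.
Proof.
apply/eqP => e; apply: (a_npow (y := 0)); apply: (fmorph_inj (in_alg K0)).
by rewrite rmorphXn rmorph0 /= -z0p e.
Qed.

Let rs := [seq (xi%:A : K0) ^+ i * z0 | i <- index_iota 0 p].

Let P_split : map_poly (in_alg K0) P = \prod_(r <- rs) ('X - r%:P).
Proof. by rewrite map_P /= -z0p (Xn_sub_factor p_pr xi0P z00) big_map. Qed.

Let rs_uniq : uniq rs.
Proof.
rewrite map_inj_in_uniq ?iota_uniq // => i k.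
rewrite !mem_index_iota /= => ip kp /(mulIf z00)/eqP.
by rewrite (eq_prim_root_expr xi0P) !modn_small // => /eqP.
Qed.

Let P_splitting : splittingFieldFor 1 (map_poly (in_alg K0) P) {:K0}.
Proof.
exists rs; first by rewrite P_split eqpxx.
apply/eqP; rewrite eqEsubv subvf; apply/subvP => w _; have [q [_ ->]] := z0E w.
have sz : (<<1; z0>> <= <<1 & rs>>)%VS.
  apply/FadjoinP; split; first exact: subv_adjoin_seq.
  apply: seqv_sub_adjoin; apply/mapP; exists 0%N; rewrite ?expr0 ?mul1r //.
  by rewrite mem_index_iota.
by apply: (subvP sz); apply/Fadjoin1_polyP; exists q.
Qed.

Let K0_axiom : splitting_field_axiom K0.
Proof.
by exists (map_poly (in_alg K0) P); [exact: alg_polyOver | exact: P_splitting].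
Qed.

Let K1 : splittingFieldType F :=
  HB.pack K0 (FieldExt_isSplittingField.Build F K0 K0_axiom).

Lemma Kummer_ext : exists (K : splittingFieldType F) (z : K) (j : {rmorphism K -> W}),
  [/\ cyclic_ext p K, z ^+ p = a%:A, j z = alpha, forall c : F, j c%:A = iota c &
    forall w : K, exists q : {poly F}, (size q <= p)%N /\ w = (map_poly (in_alg K) q).[z]].
Proof.
exists K1, z0, j0; split=> //.
have galK : galois 1 {:K1}.
  apply/splitting_galoisField; exists (map_poly (in_alg K0) P); split.
  - exact: alg_polyOver.
  - by rewrite P_split separable_prod_XsubC.
  - exact: P_splitting.
have dimK : \dim {:K1} = p.
  by rewrite dimvf -[RHS]/(p.+1.-1) -(size_XnsubC a p_gt0).
split=> //; apply: prime_cyclic.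
by rewrite -galois_dim // dimv1 divn1 dimK.
Qed.

End KummerExtension.

Section KummerNorm.
Variables (F : fieldType) (K : splittingFieldType F) (p : nat) (xi a : F) (z : K).
Hypotheses (p_pr : prime p) (xiP : p.-primitive_root xi) (a0 : a != 0).
Hypotheses (cK : cyclic_ext p K) (zp : z ^+ p = a%:A).

Let p_gt0 : (0 < p)%N := prime_gt0 p_pr.

Lemma card_Gal : #|'Gal({:K} / 1)%g| = p.
Proof. by case: cK => galK _ dimK; rewrite -galois_dim // dimv1 divn1. Qed.

Lemma gal_alg (s : gal_of {:K}) (c : F) : s \in 'Gal({:K} / 1)%g -> s c%:A = c%:A.
Proof. by move=> sG; rewrite (fixed_gal _ sG) ?sub1v ?rpredZ ?mem1v. Qed.

Lemma galNorm_alg (c : F) : galNorm 1 {:K} c%:A = (c ^+ p)%:A.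
Proof.
rewrite /galNorm (eq_bigr (fun=> c%:A)) => [|s sG]; last exact: gal_alg.
by rewrite prodr_const card_Gal -!in_algE rmorphXn.
Qed.

Let z0 : z != 0.
Proof.
apply: contraNneq a0 => e; move/eqP: zp; rewrite e expr0n gtn_eqF //.
by rewrite eq_sym -in_algE fmorph_eq0.
Qed.

Lemma gal_expr (s : gal_of {:K}) : s \in 'Gal({:K} / 1)%g -> s z ^+ p = a%:A.
Proof. by move=> sG; rewrite -rmorphXn zp; exact: gal_alg. Qed.

Lemma gal_root (s : gal_of {:K}) : s \in 'Gal({:K} / 1)%g ->
  exists k : nat, s z = (xi ^+ k)%:A * z.
Proof.
move=> sG; have xiKP : p.-primitive_root (xi%:A : K).
  by rewrite -in_algE fmorph_primitive_root.
have : (s z / z) ^+ p = 1.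
  by rewrite expr_div_n gal_expr // -zp mulfV // expf_neq0.
case/(prim_rootP xiKP) => k ek; exists k.
by rewrite -in_algE rmorphXn /= -ek divfK.
Qed.

Lemma gal_inj : (forall w : K, exists q : {poly F}, w = (map_poly (in_alg K) q).[z]) ->
  {in 'Gal({:K} / 1)%g &, injective (fun s : gal_of {:K} => s z)}.
Proof.
move=> zE s t sG tG e; apply/eqP/gal_eqP => w _; have [q ->] := zE w.
have h (u : gal_of {:K}) : u \in 'Gal({:K} / 1)%g ->
    u (map_poly (in_alg K) q).[z] = (map_poly (in_alg K) q).[u z].
  move=> uG; rewrite -horner_map; congr (_.[_]); apply/polyP => i.
  by rewrite !coef_map; exact: gal_alg.
by rewrite !h // e.
Qed.

(** The conjugates of z are p distinct roots of X^p - a, hence all of them, and the factorization is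
    evaluated at c. Injectivity is left as a hypothesis because it comes either from z generating K
    or from the explicit action of a generator of the Galois group. *)
Lemma galNorm_sub (c : F) :
  {in 'Gal({:K} / 1)%g &, injective (fun s : gal_of {:K} => s z)} ->
  galNorm 1 {:K} (c%:A - z) = (c ^+ p - a)%:A.
Proof.
move=> z_inj.
have e : 'X^p - (a%:A)%:P = \prod_(s in 'Gal({:K} / 1)%g) ('X - (s z)%:P).
  rewrite -big_filter -/(enum _); rewrite -(big_map _ xpredT (fun r => 'X - r%:P)).
  have mon : ('X^p - (a%:A)%:P : {poly K}) \is monic by rewrite monicXnsubC.
  rewrite [LHS](@all_roots_prod_XsubC _ _ [seq s z | s : gal_of {:K} <- enum 'Gal({:K} / 1)%g]).
  - by rewrite (monicP mon) scale1r.
  - by rewrite size_XnsubC // size_map -cardE card_Gal.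
  - apply/allP => r /mapP[s]; rewrite mem_enum => sG ->.
    by rewrite rootE !hornerE gal_expr // subrr.
  - rewrite uniq_rootsE map_inj_in_uniq ?enum_uniq // => s t.
    by rewrite !mem_enum; apply: z_inj.
rewrite /galNorm; transitivity (('X^p - (a%:A)%:P).[c%:A] : K).
  rewrite e horner_prod; apply: eq_bigr => s sG.
  by rewrite rmorphB !hornerE; congr (_ - _); exact: gal_alg.
by rewrite !hornerE -!in_algE rmorphB rmorphXn.
Qed.

End KummerNorm.

(** * Dimensions of the spaces of classes *)

Section QuotientDimension.
Variables (p : nat) (p_pr : prime p) (V : zmodType) (S : zmodClosed V).
Variable pV : forall v : Quotient.quot S, v *+ p = 0.
Variables (I : Type) (b : I -> V).

Lemma quot_has_dim :
  (forall n (s : 'I_n -> I) (k : 'I_n -> nat), injective s ->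
     \sum_(j < n) b (s j) *+ k j \in S -> forall j, (p %| k j)%N) ->
  (forall v, exists n (s : 'I_n -> I) (k : 'I_n -> nat),
     v - \sum_(j < n) b (s j) *+ k j \in S) ->
  has_dim (FpMod p_pr pV) I.
Proof.
move=> ind spn; pose b' i : FpMod p_pr pV := \pi_(Quotient.quot S)%qT (b i).
have piE n (s : 'I_n -> I) (k : 'I_n -> nat) :
    \sum_(j < n) b' (s j) *+ k j =
    \pi_(Quotient.quot S)%qT (\sum_(j < n) b (s j) *+ k j).
  by rewrite raddf_sum; apply: eq_bigr => j _; rewrite raddfMn.
exists b'; split=> [n s c inj_s e j|v].
  have /(_ n s (fun j => c j : nat) inj_s) h := ind.
  have : (p %| c j)%N.
    apply: h; have := piE n s (fun j => c j : nat).
    rewrite [X in X = _ -> _](_ : _ = 0); last by rewrite -[RHS]e; apply: eq_bigr.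
    move=> /esym/eqP; rewrite -(raddf0 (\pi_(Quotient.quot S))%qT).
    by rewrite -Quotient.idealrBE subr0.
  move=> pc; apply/val_inj => /=; apply/eqP; rewrite -leqn0 leqNgt; apply/negP => c0.
  have := dvdn_leq c0 pc; have := ltn_ord (c j); rewrite {2}Fp_cast //.
  by move=> h1 h2; have := leq_trans h1 h2; rewrite ltnn.
have [n [s [k h]]] := spn (repr v); exists n, s, (fun j => (k j)%:R).
rewrite (eq_bigr (fun j => b' (s j) *+ k j)) => [|j _]; last by rewrite scaler_nat.
rewrite piE -[LHS]reprK; apply/eqP.
by rewrite -Quotient.idealrBE.
Qed.

End QuotientDimension.

Section Realize.
Variables (F : fieldType) (K : splittingFieldType F) (p : nat) (p_pr : prime p).
Variable cK : cyclic_ext p K.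

Definition is_norm (c : F) := exists2 w : K, w != 0 & galNorm 1 {:K} w = c%:A.

Lemma is_norm_neq0 c : is_norm c -> c != 0.
Proof.
move=> [w w0 e]; apply: contraNneq w0 => c0.
by rewrite -(galNorm_eq0 1 {:K}) e c0 scale0r.
Qed.

Lemma is_normM c c' : is_norm c -> is_norm c' -> is_norm (c * c').
Proof.
move=> [w w0 e] [w' w0' e']; exists (w * w'); first by rewrite mulf_neq0.
by rewrite galNormM e e' -!in_algE rmorphM.
Qed.

Lemma is_normV c : is_norm c -> is_norm c^-1.
Proof.
move=> [w w0 e]; exists w^-1; first by rewrite invr_eq0.
by rewrite galNormV e -!in_algE fmorphV.
Qed.

Lemma is_norm1 : is_norm 1.
Proof. by exists 1; rewrite ?oner_neq0 // galNorm1 scale1r. Qed.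

Lemma is_normX c n : is_norm c -> is_norm (c ^+ n).
Proof.
move=> h; elim: n => [|n IH]; first by rewrite expr0; exact: is_norm1.
by rewrite exprS; apply: is_normM.
Qed.

Lemma is_norm_pow c : c != 0 -> is_norm (c ^+ p).
Proof.
move=> c0; exists c%:A; first by rewrite -in_algE fmorph_eq0.
exact: galNorm_alg.
Qed.

Lemma is_norm_prod (I : Type) (r : seq I) (f : I -> F) :
  (forall i, is_norm (f i)) -> is_norm (\prod_(i <- r) f i).
Proof.
move=> h; elim: r => [|i r IH]; first by rewrite big_nil; exact: is_norm1.
by rewrite big_cons; apply: is_normM.
Qed.

Lemma uval_sum (I : Type) (r : seq I) (f : I -> units F) :
  uval (\sum_(i <- r) f i) = \prod_(i <- r) uval (f i).
Proof.
elim: r => [|i r IH]; first by rewrite !big_nil.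
by rewrite !big_cons uvalD IH.
Qed.

Lemma normsE (c : units F) : c \in norms K <-> is_norm (uval c).
Proof. by split=> /asboolP. Qed.

Variables (D E : Type) (b : D -> F) (t : E -> F).
Hypotheses (b0 : forall d, b d != 0) (tN : forall i, is_norm (t i)).
Hypothesis b_ind : forall n (s : 'I_n -> D) (k : 'I_n -> nat), injective s ->
  is_norm (\prod_(j < n) b (s j) ^+ k j) -> forall j, (p %| k j)%N.
Hypothesis t_ind : forall n (s : 'I_n -> E) (k : 'I_n -> nat) (f : F), injective s ->
  \prod_(j < n) t (s j) ^+ k j = f ^+ p -> forall j, (p %| k j)%N.
Hypothesis bt_span : forall c, c != 0 ->
  exists (n n' : nat) (s : 'I_n -> D) (k : 'I_n -> nat) (s' : 'I_n' -> E) (k' : 'I_n' -> nat)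
    (f : F), injective s /\
    c = \prod_(j < n) b (s j) ^+ k j * \prod_(j < n') t (s' j) ^+ k' j * f ^+ p.

Lemma d_space_dim : has_dim (d_space p_pr cK) D.
Proof.
pose ub d : units F := Units (b0 d).
apply: (@quot_has_dim _ p_pr _ _ _ _ ub) => [n s k inj_s /normsE|v].
  rewrite uval_sum; under eq_bigr do rewrite uvalMn; exact: b_ind.
have [n [n' [s [k [s' [k' [f [inj_s e]]]]]]]] := bt_span (uval_neq0 v).
exists n, s, k; apply/normsE; rewrite uvalD uvalN uval_sum.
under eq_bigr do rewrite uvalMn.
have P0 : \prod_(j < n) b (s j) ^+ k j != 0.
  by rewrite prodf_seq_neq0; apply/allP => j _; rewrite expf_neq0.
rewrite e mulrC -mulrA mulKf //; apply: is_normM.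
  by apply: is_norm_prod => j; apply: is_normX.
apply: is_norm_pow; apply: contraTneq (uval_neq0 v) => f0.
by rewrite e f0 expr0n gtn_eqF ?prime_gt0 // mulr0 eqxx.
Qed.

(** In the decomposition of a norm the part made of the b_d is itself a norm, so by [b_ind] its
    exponents are divisible by p and it merges with the p-th power. *)
Lemma e_space_dim : has_dim (e_space K p_pr) E.
Proof.
have t0 i := is_norm_neq0 (tN i).
pose ut i : norm_group K := NormGroup (introT (asboolP _) (tN i) : Units (t0 i) \in norms K).
have nv_sum n (s : 'I_n -> E) (k : 'I_n -> nat) :
    uval (nval (\sum_(j < n) ut (s j) *+ k j)) = \prod_(j < n) t (s j) ^+ k j.
  have -> : nval (\sum_(j < n) ut (s j) *+ k j) = \sum_(j < n) nval (ut (s j)) *+ k j.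
    rewrite [LHS](raddf_sum (val : norm_group K -> units F)).
    by apply: eq_bigr => j _; rewrite raddfMn.
  by rewrite uval_sum; apply: eq_bigr => j _; rewrite uvalMn.
apply: (@quot_has_dim _ p_pr _ _ _ _ ut) => [n s k inj_s /asboolP[y e]|v].
  apply: (t_ind (f := uval y) inj_s); rewrite -nv_sum e uvalMn //.
have [n [n' [s [k [s' [k' [f [inj_s e]]]]]]]] := bt_span (uval_neq0 (nval v)).
exists n', s', k'; apply/asboolP.
have f0 : f != 0.
  apply: contraTneq (uval_neq0 (nval v)) => f0.
  by rewrite e f0 expr0n gtn_eqF ?prime_gt0 // mulr0 eqxx.
have T0 : \prod_(j < n') t (s' j) ^+ k' j != 0.
  by rewrite prodf_seq_neq0; apply/allP => j _; rewrite expf_neq0.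
have pk : forall j, (p %| k j)%N.
  apply: (b_ind inj_s).
  have -> : \prod_(j < n) b (s j) ^+ k j = uval (nval v) *
      (\prod_(j < n') t (s' j) ^+ k' j * f ^+ p)^-1.
    by rewrite e -[X in X * _^-1]mulrA mulfK // mulf_neq0 ?expf_neq0.
  apply: is_normM; first by apply/normsE; exact: nvalP.
  apply: is_normV; apply: is_normM; last exact: is_norm_pow.
  by apply: is_norm_prod => j; apply: is_normX.
pose g := \prod_(j < n) b (s j) ^+ (k j %/ p).
have g0 : g * f != 0.
  by rewrite mulf_neq0 // prodf_seq_neq0; apply/allP => j _; rewrite expf_neq0.
exists (Units g0); rewrite [LHS](raddfB (val : norm_group K -> units F)).
apply: val_inj; rewrite [LHS]uvalD uvalN nv_sum [RHS]uvalMn e /=.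
have -> : \prod_(j < n) b (s j) ^+ k j = g ^+ p.
  by rewrite -prodrXl; apply: eq_bigr => j _; rewrite -exprM divnK.
by rewrite exprMn mulrAC mulfK.
Qed.

End Realize.

(** * Necessity of the conditions *)

Section Necessity.
Variables (F : fieldType) (K : splittingFieldType F) (p : nat) (p_pr : prime p).
Variables (cK : cyclic_ext p K) (xi : F) (xiP : p.-primitive_root xi).

Lemma d_space_empty (D : Type) c : has_dim (d_space p_pr cK) D -> (D -> False) -> c != 0 ->
  is_norm K c.
Proof.
move=> [b [_ spn]] nD c0.
have [n [s [k e]]] := spn (\pi_(Quotient.quot (norms K))%qT (Units c0)).
case: n => [|n] in s k e *; last by case: (nD (s ord0)).
rewrite big_ord0 in e.
have : Units c0 - 0 \in norms K by rewrite Quotient.idealrBE e raddf0.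
by rewrite subr0 => /normsE.
Qed.

Lemma e_space_empty (E : Type) c : has_dim (e_space K p_pr) E -> (E -> False) ->
  is_norm K c -> exists y : F, c = y ^+ p.
Proof.
move=> [b [_ spn]] nE cN.
have cn : Units (is_norm_neq0 cN) \in norms K by apply/normsE.
have [n [s [k e]]] := spn (\pi_(Quotient.quot (pth_powers (K:=K) p))%qT (NormGroup cn)).
case: n => [|n] in s k e *; last by case: (nE (s ord0)).
rewrite big_ord0 in e.
have : NormGroup cn - 0 \in pth_powers (K:=K) p by rewrite Quotient.idealrBE e raddf0.
rewrite subr0 => /asboolP[y ey]; exists (uval y).
by rewrite -uvalMn -ey.
Qed.

Lemma Kummer_element : exists (z : K) (a : F),
  [/\ z \notin 1%VS, a != 0, z ^+ p = a%:A & is_norm K (- a)].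
Proof.
have [galK cyc dimK] := cK; have cG := card_Gal cK.
have [s gs] := cyclicP cyc.
have gen : generator 'Gal({:K} / 1) s by rewrite /generator gs.
have sG : s \in 'Gal({:K} / 1)%g by rewrite gs cycle_id.
(* Hilbert 90 is applied to xi^-1, of norm xi^-p = 1: it gives z with z / s(z) = xi^-1, so the
   generator s multiplies z by xi. *)
have N1 : galNorm 1 {:K} (xi^-1)%:A = 1.
  rewrite (galNorm_alg cK) exprVn (prim_expr_order xiP) invr1.
  exact: scale1r.
have [|z [_ z0] ez] := elimT (Hilbert's_theorem_90 (a := (xi^-1)%:A) gen (memvf _)).
  by rewrite N1.
have xi0 : xi != 0 by rewrite (prim_root_eq0 xiP) -lt0n prime_gt0.
have sz : s z = xi%:A * z.
  have sz0 : s z != 0 by rewrite fmorph_eq0.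
  have := congr1 (fun u => xi%:A * (u * s z)) ez; rewrite divfK // => <-.
  by rewrite mulrA -!in_algE -rmorphM mulfV // rmorph1 mul1r.
have szn n : (s ^+ n)%g z = (xi ^+ n)%:A * z.
  elim: n => [|n IH]; first by rewrite expg0 gal_id expr0 scale1r mul1r.
  rewrite expgSr galM ?memvf // IH rmorphM /= sz (gal_alg _ sG) mulrA.
  by rewrite -!in_algE -rmorphM /= -exprSr.
have zp1 : z ^+ p \in 1%VS.
  rewrite -(galois_fixedField galK); apply/fixedFieldP; first exact: memvf.
  move=> t; rewrite gs => /cycleP[n ->]; rewrite rmorphXn /= szn exprMn.
  by rewrite -in_algE -rmorphXn -exprM mulnC exprM (prim_expr_order xiP) expr1n rmorph1 mul1r.
have [a ea] := vlineP _ _ zp1.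
have a0 : a != 0.
  have : z ^+ p != 0 by rewrite expf_neq0.
  by rewrite ea; apply: contraNneq => ->; rewrite scale0r.
have z_inj : {in 'Gal({:K} / 1)%g &, injective (fun t : gal_of {:K} => t z)}.
  move=> t u; rewrite gs => /cycleP[i ->] /cycleP[k ->]; rewrite !szn.
  move=> /(mulIf z0)/(fmorph_inj (in_alg K))/eqP; rewrite (eq_prim_root_expr xiP).
  by rewrite -cG gs => /eqP e; apply/eqP; rewrite eq_expg_mod_order; apply/eqP.
exists z, a; split=> //.
  apply/negP => z1; have := fixed_gal (sub1v _) sG z1.
  rewrite sz => /eqP; rewrite -subr_eq0 -{2}[z]mul1r -mulrBl mulf_eq0 (negPf z0) orbF.
  rewrite -in_algE -(rmorph1 (in_alg K)) -rmorphB fmorph_eq0 subr_eq0.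
  rewrite -[xi]expr1 -(prim_order_dvd xiP) dvdn1 => /eqP p1.
  by move: p_pr; rewrite p1.
exists (- z); first by rewrite oppr_eq0.
have := galNorm_sub p_pr cK ea 0 z_inj.
by rewrite scale0r sub0r expr0n gtn_eqF ?prime_gt0 // sub0r.
Qed.

Lemma e_space_inhabited (E : Type) : has_dim (e_space K p_pr) E ->
  is_norm K (-1) -> ~ (E -> False).
Proof.
move=> dE N1 nE; have [z [a [z1 a0 za Na]]] := Kummer_element.
have [|y ay] := e_space_empty (c := a) dE nE.
  by rewrite -[a]opprK -mulN1r; apply: is_normM.
case/negP: z1; have xiKP : p.-primitive_root (xi%:A : K).
  by rewrite -in_algE fmorph_primitive_root.
have y0 : y%:A != 0 :> K.
  rewrite -in_algE fmorph_eq0; apply: contraNneq a0 => y0.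
  by rewrite ay y0 expr0n gtn_eqF ?prime_gt0.
have : (z / y%:A) ^+ p = 1.
  rewrite expr_div_n za -in_algE -in_algE -rmorphXn -ay mulfV //.
  by rewrite fmorph_eq0.
case/(prim_rootP xiKP) => k ek.
have -> : z = (xi ^+ k * y)%:A.
  by rewrite -in_algE rmorphM rmorphXn /= -ek divfK.
by rewrite rpredZ // mem1v.
Qed.

End Necessity.

(** * Power classes of a maximal field with prescribed leading terms *)

Section DominantTerm.
Variables (W : fieldType) (m : W -> Prop).
Hypothesis mP : val_ideal m.

Lemma dominant_ex (f : nat -> W) (s : seq nat) :
  (forall i l, i \in s -> l \in s -> i != l -> f i != 0 -> f l != 0 ->
     vlt m (f i) (f l) \/ vlt m (f l) (f i)) ->
  (exists2 i, i \in s & f i != 0) ->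
  exists i, [/\ i \in s, f i != 0 & forall l, l \in s -> l != i -> vlt m (f l) (f i)].
Proof.
elim: s => [_ [i]//|i s IH] tot ex.
have [[i' i's fi']|ns] := pselect (exists2 i, i \in s & f i != 0); last first.
  have fi : f i != 0.
    case: ex => i'; rewrite in_cons => /predU1P[->//|i's fi'].
    by case: ns; exists i'.
  exists i; rewrite mem_head; split=> // l; rewrite in_cons => /predU1P[->|ls _].
    by rewrite eqxx.
  have -> : f l = 0 by apply/eqP; apply: contraT => fl; case: ns; exists l.
  exact: vlt0.
have [||k [ks fk kP]] := IH; last 1 first.
- have [e|ik] := eqVneq i k.
    exists k; rewrite in_cons ks orbT; split=> // l; rewrite in_cons e.
    by case/predU1P => [->|]; [rewrite eqxx | exact: kP].
  have [fi0|fi0] := eqVneq (f i) 0.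
    exists k; rewrite in_cons ks orbT; split=> // l; rewrite in_cons.
    case/predU1P => [-> _|]; [rewrite fi0; exact: vlt0 | exact: kP].
  have [h|h] := tot i k (mem_head _ _) (mem_behead (s := i :: s) ks) ik fi0 fk.
    exists k; rewrite in_cons ks orbT; split=> // l; rewrite in_cons.
    by case/predU1P => [-> _|]; [exact: h | exact: kP].
  exists i; rewrite mem_head; split=> // l; rewrite in_cons.
  case/predU1P => [->|ls _]; first by rewrite eqxx.
  have [->//|lk] := eqVneq l k.
  exact: vlt_trans (kP l ls lk) h.
- by move=> i1 l1 h1 h2; apply: tot; rewrite in_cons ?h1 ?h2 orbT.
- by exists i'.
Qed.

Lemma vsim_sum (g : nat -> W) (n i : nat) : (i < n)%N -> g i != 0 ->
  (forall l, (l < n)%N -> l != i -> vlt m (g l) (g i)) ->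
  vsim m (\sum_(l < n) g l) (g i).
Proof.
move=> ip gi h; rewrite (bigD1 (Ordinal ip)) //=; apply: vsim_addr.
apply: (big_ind (fun u => vlt m u (g i))) => [|u v|l li]; first exact: vlt0.
  exact: vltD.
exact: h.
Qed.

Lemma vlt_root u v n : (0 < n)%N -> vlt m (u ^+ n) (v ^+ n) -> vlt m u v.
Proof.
move=> n0 [vn h]; have v0 : v != 0 by move: vn; rewrite expf_eq0 n0.
split=> //; move: h; rewrite -expr_div_n.
elim: n n0 {vn} => // -[|n] IH _; first by rewrite expr1.
by rewrite exprS => /(val_prime mP)[//|]; apply: IH.
Qed.

End DominantTerm.

Section Core.
Variables (W : closedFieldType) (m : W -> Prop) (L : divringClosed W) (J : eqType)
  (x : J -> W) (p : nat) (xi : W).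
Hypotheses (mP : val_ideal m) (Lm : forall l, l \in L -> l != 0 -> ~ m l).
Hypothesis x0 : forall j, x j != 0.
Hypothesis xm : forall s (n : J -> int), uniq s -> (exists2 j, j \in s & n j != 0) ->
  m (mon x s n) \/ m (mon x s n)^-1.
Hypotheses (p_pr : prime p) (xiP : p.-primitive_root xi) (Lxi : xi \in L).
Hypothesis Lpow : forall z, z \in L -> z != 0 -> exists k : nat,
  exists2 y, y \in L & z = xi ^+ k * y ^+ p.
Variables (A : J -> Prop) (H : divringClosed W).
Hypotheses (LH : {subset L <= H}) (xH : forall j, A j -> x j \in H).
Hypotheses (domH : dominated m (monG x L A) H)
  (maxH : forall H' : divringClosed W, {subset H <= H'} ->
     dominated m (monG x L A) H' -> {subset H' <= H}).

Let p_gt0 : (0 < p)%N := prime_gt0 p_pr.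
Let xi0 : xi != 0. Proof. by rewrite (prim_root_eq0 xiP) -lt0n. Qed.

Lemma max_unit_pow c : c \in H -> vsim m c 1 -> exists2 h, h \in H & h ^+ p = c.
Proof.
apply: (@Hensel W m p xi mP p_pr xiP (monG x L A) H) => //.
- exact: monGM.
- exact: monGV.
- exact: LH.
- move=> i /andP[i0 ip]; apply: Lm; first by rewrite rpredB ?rpred1 ?rpredX.
  rewrite subr_eq0 eq_sym -(prim_order_dvd xiP); apply/negP => /(dvdn_leq i0).
  by rewrite leqNgt ip.
Qed.

Lemma mon_max s n : (forall j, n j != 0 -> A j) -> mon x s n \in H.
Proof.
move=> An; apply: rpred_prod => j _; have [->|/An/xH] := eqVneq (n j) 0.
  by rewrite expr0z rpred1.
by case: (n j) => k Hx; rewrite ?rpredV rpredX.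
Qed.

Lemma max_decomp h : h \in H -> h != 0 -> exists (k : nat) (n : J -> int) (s : seq J),
  [/\ supp n s, forall j, n j != 0 -> A j & exists2 u, u \in H & h = xi ^+ k * mon x s n * u ^+ p].
Proof.
move=> Hh h0; have [_ [l [n [s [Ll l0 sn An ->]]]] hl] := domH Hh h0.
have [k [y Ly ey]] := Lpow Ll l0; exists k, n, s; split=> //.
have l'0 : l * mon x s n != 0 by rewrite mulf_neq0 ?mon_neq0.
have [|v Hv ev] := max_unit_pow _ (vsim_div mP l'0 hl).
  by rewrite rpred_div // rpredM //; [exact: LH | exact: mon_max].
exists (y * v); first by rewrite rpredM //; exact: LH.
have -> : h = h / (l * mon x s n) * (l * mon x s n) by rewrite divfK.
by rewrite -ev {1}ey exprMn; ring.
Qed.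

(** The leading term of u^p is the p-th power of an element of L^x <x_j>, and leading terms are
    unique by [mon_inj]. *)
Lemma max_indep l n s u : l \in L -> l != 0 -> supp n s -> u \in H ->
  l * mon x s n = u ^+ p ->
  (forall j, (p%:Z %| n j)%Z) /\ exists2 y, y \in L & l = y ^+ p.
Proof.
move=> Ll l0 sn Hu e.
have u0 : u != 0.
  have : u ^+ p != 0 by rewrite -e mulf_neq0 ?mon_neq0.
  by apply: contraNneq => ->; rewrite expr0n gtn_eqF.
have [_ [l' [n' [s' [Ll' l'0 sn' _ ->]]]] hu] := domH Hu u0.
have := vsimX mP p hu; rewrite -e exprMn -monX // => hs.
have sn'' : supp (fun j => n' j *+ p) s'.
  case: sn' => us h; split=> // j; apply: contraNT => /negP nj.
  have [->|/h//] := eqVneq (n' j) 0; by rewrite mul0rn.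
have [||el en] := mon_inj x0 mP Lm xm Ll _ l0 _ sn sn'' hs.
- by rewrite rpredX.
- by rewrite expf_neq0.
split=> [j|]; last by exists l'.
by rewrite en -mulr_natr natz dvdz_mull.
Qed.

(* Norms from H(x_j0 ^ 1/p): the exponent of x_j0 is read off the leading term. *)
Lemma max_indep_norm j0 (r i : nat) n s u : supp n s -> n j0 = 0 -> u \in H ->
  xi ^+ r * mon x s n = (- x j0) ^+ i * u ^+ p ->
  (forall j, (p%:Z %| n j)%Z) /\ exists2 y, y \in L & xi ^+ r = y ^+ p.
Proof.
move=> sn n0 Hu e.
pose e0 j := - (unitv j0 j *+ i).
have se0 : supp e0 [:: j0].
  apply: suppN; case: (supp_unitv j0) => us h; split=> // j nj.
  by apply: h; apply: contraNneq nj => ->; rewrite mul0rn.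
have mone0 : mon x [:: j0] e0 = x j0 ^- i by rewrite monN // monX // mon_unitv.
pose s' := undup (s ++ [:: j0]); pose n' j := n j + e0 j.
have sn' : supp n' s'.
  by apply: suppD; [exact: supp_catl sn se0 | exact: supp_catr sn se0].
have em : mon x s' n' = mon x s n / x j0 ^+ i.
  rewrite monD // -(mon_ext x sn (supp_catl sn se0)).
  by rewrite -(mon_ext x se0 (supp_catr sn se0)) mone0.
have Ll : xi ^+ r * (-1) ^+ i \in L by rewrite rpredM ?rpredX ?rpredN ?rpred1.
have l0 : xi ^+ r * (-1) ^+ i != 0 by rewrite mulf_neq0 ?signr_eq0 ?expf_neq0.
have [|dn [y Ly ey]] := max_indep (u := u) Ll l0 sn' Hu.
  have xi0' : x j0 ^+ i != 0 by rewrite expf_neq0.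
  rewrite em; set M := mon x s n in e *; set X := x j0 ^+ i in xi0' *.
  have -> : xi ^+ r * (-1) ^+ i * (M / X) = (-1) ^+ i * (xi ^+ r * M) * X^-1 by ring.
  rewrite e (exprNn (x j0)) -/X; set S := (-1) ^+ i.
  have -> : S * (S * X * u ^+ p) * X^-1 = S * S * (X * X^-1) * u ^+ p by ring.
  by rewrite mulfV // /S -exprMn mulrNN !mulr1 expr1n mul1r.
(* The monomial n does not involve j0, so the total exponent there is -i. Once p divides i, the sign
   (-1)^i is a p-th power and can be removed from the coefficient. *)
have pi : (p %| i)%N.
  have := dn j0; rewrite /n' n0 add0r /e0 /unitv eqxx rpredN -mulr_natr mul1r natz.
  by rewrite dvdzE.
split=> [j|].
  have := dn j; rewrite /n' rpredDr // /e0 rpredN -mulr_natr dvdz_mull // natz dvdzE //.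
exists (y * (-1) ^+ (i %/ p)).
  by rewrite rpredM // rpredX // rpredN rpred1.
rewrite exprMn -ey -exprM divnK // -mulrA -exprMn mulrNN mulr1 expr1n mulr1 //.
Qed.


(** A form of [max_decomp] suited to the norms: natural exponents, and -x_j0 set apart, because
    -x_j0 rather than x_j0 is the norm in the ramified case. *)
Lemma max_decomp_nat j0 h : h \in H -> h != 0 ->
  exists (k : nat) (s : seq J) (n : J -> nat) (n0 : nat) u,
  [/\ uniq s, j0 \notin s, forall j, j \in s -> A j, u \in H /\ (~ A j0 -> n0 = 0%N) &
    h = xi ^+ k * \prod_(j <- s) x j ^+ n j * (- x j0) ^+ n0 * u ^+ p].
Proof.
move=> Hh h0.
have [k [n [s [[us sn] An [u Hu eh]]]]] := max_decomp Hh h0.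
(* The integer n + p|n| is nonnegative and congruent to n modulo p; the surplus goes into the p-th
   power v^p. *)
pose n1 j : nat := absz (n j + (p * absz (n j))%:Z).
pose v := \prod_(j <- s) (x j ^- (absz (n j))).
have n1E j : (n1 j)%:Z = n j + (p * absz (n j))%:Z.
  by rewrite /n1; have := p_gt0; nia.
have xE j : x j ^ n j = x j ^+ n1 j * (x j ^- (absz (n j))) ^+ p.
  rewrite -[x j ^+ n1 j]/(x j ^ (n1 j)%:Z) n1E expfzDr // exprVn -exprM mulnC.
  by rewrite -mulrA mulfV ?mulr1 // expf_neq0.
have mE : mon x s n = \prod_(j <- s) x j ^+ n1 j * v ^+ p.
  by rewrite /mon -prodrXl -big_split; apply: eq_bigr.
have Hv : v \in H.
  apply: rpred_prod => j _; have [->|/An/xH Hx] := eqVneq (n j) 0.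
    by rewrite expr0 invr1 rpred1.
  by rewrite rpredV rpredX.
have n10 j : n j = 0 -> n1 j = 0%N by rewrite /n1 => ->; rewrite muln0.
pose s1 := [seq j <- s | (n j != 0) && (j != j0)].
have sE : \prod_(j <- s) x j ^+ n1 j = \prod_(j <- s1) x j ^+ n1 j * x j0 ^+ n1 j0.
  rewrite (bigID (fun j => (n j != 0) && (j != j0))) /= big_filter; congr (_ * _).
  have [j0s|j0s] := boolP (j0 \in s).
    rewrite big_mkcond (bigD1_seq j0) //= eqxx andbF /= big1 ?mulr1 // => j jj0.
    by rewrite jj0 andbT negbK; case: eqP => // /n10 ->.
  have nj0 : n j0 = 0 by apply/eqP; apply: contraNT j0s => /sn.
  rewrite (n10 _ nj0) big_seq_cond big1 // => j /andP[js].
  have jj0 : j != j0 by apply: contraNneq j0s => <-.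
  by rewrite jj0 andbT negbK => /eqP /n10 ->.
(* Passing from x_j0 to -x_j0 costs a sign, which [Lpow] turns into a power of xi times a p-th
   power. *)
have L1 : (-1) ^+ n1 j0 \in L by rewrite rpredX ?rpredN ?rpred1.
have L1n : (-1) ^+ n1 j0 != 0 :> W by rewrite signr_eq0.
have [k2 [y Ly ey]] := Lpow L1 L1n.
exists (k + k2)%N, s1, n1, (n1 j0), (u * v * y); split.
- by rewrite filter_uniq.
- by rewrite mem_filter eqxx andbF.
- by move=> j; rewrite mem_filter => /andP[/andP[/An]].
- split; first by rewrite !rpredM //; exact: LH.
  by move=> nA; apply: n10; apply/eqP; apply: contraT => /An.
- rewrite eh mE sE exprD !exprMn exprNn; set M := \prod_(j <- s1) _.
  have eS : xi ^+ k2 * y ^+ p * (-1) ^+ n1 j0 = 1 :> W.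
    by rewrite -ey -exprMn mulrNN mulr1 expr1n.
  transitivity (xi ^+ k * (M * x j0 ^+ n1 j0 * v ^+ p) * u ^+ p *
    (xi ^+ k2 * y ^+ p * (-1) ^+ n1 j0)); first by rewrite eS mulr1.
  by ring.
Qed.

Section Norm.
Variables (F : divringClosed W) (K : splittingFieldType (sfield F)) (z : K)
  (jK : {rmorphism K -> W}) (xiF a : sfield F) (alpha : W) (j0 : J).
Hypotheses (FH : {subset F <= H}) (cK : cyclic_ext p K) (zp : z ^+ p = a%:A)
  (jz : jK z = alpha) (jA : forall c : sfield F, jK c%:A = val c).
Hypothesis zE : forall w : K, exists q : {poly (sfield F)},
  (size q <= p)%N /\ w = (map_poly (in_alg K) q).[z].
Hypotheses (xiFE : val xiF = xi) (aE : val a = x j0) (alphaP : alpha ^+ p = x j0).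
Hypothesis Aj0 : A j0.

Let xiFP : p.-primitive_root xiF.
Proof. by move: xiP; rewrite -xiFE fmorph_primitive_root. Qed.

Let a0 : a != 0.
Proof.
apply/eqP => e; have := x0 j0; rewrite -aE e rmorph0; by rewrite eqxx.
Qed.

Let alpha0 : alpha != 0.
Proof. by apply: contraNneq (x0 j0) => e; rewrite -alphaP e expr0n gtn_eqF. Qed.

(** The nonzero terms q_l alpha^l of w have distinct values, so one of them, of index i, dominates,
    and it does so in every conjugate. Hence N(w) has the leading term of N(q_i z^i), which is
    (-x_j0)^i times a p-th power, and the remaining 1-unit is a p-th power in H. *)
Lemma norm_max (w : K) (c : sfield F) : w != 0 -> galNorm 1 {:K} w = c%:A ->
  exists (i : nat) u, u \in H /\ val c = (- x j0) ^+ i * u ^+ p.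
Proof.
move=> w0 Nw; have [q [sq ew]] := zE w.
pose f l : W := val (q`_l) * alpha ^+ l.
have jsig (s : gal_of {:K}) k : s \in 'Gal({:K} / 1)%g -> s z = (xiF ^+ k)%:A * z ->
    jK (s w) = \sum_(l < p) f l * xi ^+ (k * l).
  move=> sG sz; rewrite ew (horner_coef_wide z (n := p)); last first.
    by rewrite size_map_poly.
  rewrite !rmorph_sum; apply: eq_bigr => l _; rewrite coef_map !rmorphM /=.
  rewrite [s _](gal_alg _ sG) jA rmorphXn /= sz !rmorphXn rmorphM /= jA jz.
  by rewrite rmorphXn /= xiFE exprMn -exprM /f -mulrA [alpha ^+ l * _]mulrC.
have fw0 : exists2 i, i \in iota 0 p & f i != 0.
  apply: contrapT => nf; case/eqP: w0; rewrite ew (horner_coef_wide z (n := p)); last first.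
    by rewrite size_map_poly.
  rewrite big1 // => l _; rewrite coef_map /=.
  suff -> : q`_l = 0 by rewrite scale0r mul0r.
  apply/eqP; apply: contraT => ql; case: nf; exists (l : nat); first by rewrite mem_iota /=.
  by rewrite mulf_neq0 ?expf_neq0 // -(rmorph0 (val : sfield F -> W)) (inj_eq val_inj).
(* Since alpha need not lie in H, values are compared after taking p-th powers: f_l^p = q_l^p x_j0^l
   has exponent congruent to l at j0. *)
have fp l : f l != 0 -> exists lam n s, [/\ lam \in L, lam != 0, supp n s,
    vsim m (f l ^+ p) (lam * mon x s n) & (n j0 = l %[mod p])%Z].
  move=> fl; have ql : val q`_l != 0 by apply: contraNneq fl => e; rewrite /f e mul0r.
  have Hq : val q`_l \in H by apply: FH; exact: sfvalP.
  have [_ [lam [n [s [Ll l0 sn _ ->]]]] hq] := domH Hq ql.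
  pose n1 j := n j *+ p + unitv j0 j *+ l.
  pose s1 := undup (s ++ [:: j0]).
  have sp : supp (fun j => n j *+ p) s.
    case: sn => us h; split=> // j nj; apply: h.
    by apply: contraNneq nj => ->; rewrite mul0rn.
  have sl : supp (fun j => unitv j0 j *+ l) [:: j0].
    case: (supp_unitv j0) => us h; split=> // j nj; apply: h.
    by apply: contraNneq nj => ->; rewrite mul0rn.
  exists (lam ^+ p), n1, s1; split.
  - by rewrite rpredX.
  - by rewrite expf_neq0.
  - by apply: suppD; [exact: supp_catl sp sl | exact: supp_catr sp sl].
  - rewrite monD // -(mon_ext x sp (supp_catl sp sl)) -(mon_ext x sl (supp_catr sp sl)).
    rewrite !monX // mon_unitv /f exprMn -exprM mulnC exprM alphaP mulrA -exprMn.
    apply: vsimM => //; first exact: vsimX.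
    by apply: vsim_refl => //; rewrite expf_neq0.
  - by rewrite /n1 /unitv eqxx -(mulr_natr (n j0)) !natz modzMDl.
have tot i l : i \in iota 0 p -> l \in iota 0 p -> i != l -> f i != 0 -> f l != 0 ->
    vlt m (f i) (f l) \/ vlt m (f l) (f i).
  rewrite !mem_iota /= => ip lp il fi fl.
  have [la [n [s [Ll l0 sn hs hn]]]] := fp i fi.
  have [la' [n' [s' [Ll' l0' sn' hs' hn']]]] := fp l fl.
  have nn : n j0 != n' j0.
    apply: contra il => /eqP e; move: hn; rewrite e hn' !modz_nat.
    by rewrite (modn_small ip) (modn_small lp) => -[->].
  have [h|h] := mon_total x0 mP Lm xm Ll Ll' l0 l0' sn sn' nn; [left|right].
    apply: (vlt_root mP p_gt0); apply: (vlt_siml mP hs).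
    exact: (vlt_simr mP h (vsim_sym mP hs')).
  apply: (vlt_root mP p_gt0); apply: (vlt_siml mP hs').
  exact: (vlt_simr mP h (vsim_sym mP hs)).
have [i [ip fi dom]] := dominant_ex mP tot fw0.
rewrite mem_iota /= in ip.
have unit_xi k : xi ^+ k != 0.
  by rewrite expf_neq0 // (prim_root_eq0 xiP) -lt0n.
(* Conjugation multiplies the term of index l by a power of xi, a unit, and so preserves the
   dominant index. *)
have sims (s : gal_of {:K}) : s \in 'Gal({:K} / 1)%g ->
    vsim m (jK (s w)) (jK (s ((q`_i)%:A * z ^+ i))).
  move=> sG; have [k sz] := gal_root p_pr xiFP a0 zp sG.
  rewrite (jsig s k) //.
  have -> : jK (s ((q`_i)%:A * z ^+ i)) = f i * xi ^+ (k * i).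
    rewrite !rmorphM /= [s _%:A](gal_alg _ sG) jA !rmorphXn /= sz rmorphM /= jA jz.
    by rewrite rmorphXn /= xiFE exprMn -exprM /f -mulrA [alpha ^+ i * _]mulrC.
  apply: (@vsim_sum _ _ mP (fun l => f l * xi ^+ (k * l))) => //.
    by rewrite mulf_neq0.
  move=> l lp li; have [_ h] : vlt m (f l) (f i) by apply: dom; rewrite ?mem_iota.
  split; first by rewrite mulf_neq0.
  rewrite -mulf_div; apply: (valM mP) => //; apply: Lm.
    by rewrite invf_div rpred_div ?rpredX.
  by rewrite invf_div mulf_neq0 ?invr_eq0.
have z_inj : {in 'Gal({:K} / 1)%g &, injective (fun s : gal_of {:K} => s z)}.
  by apply: (gal_inj (z := z)) => // w'; have [q' [_ ->]] := zE w'; exists q'.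
have Nz : galNorm 1 {:K} z = ((-1) ^+ p * - a)%:A.
  have := galNorm_sub p_pr cK zp 0 z_inj.
  rewrite scale0r sub0r expr0n gtn_eqF // sub0r => Nz.
  have -> : z = (-1)%:A * (- z) by rewrite scaleN1r mulrNN mul1r.
  by rewrite galNormM Nz (galNorm_alg cK) -!in_algE -rmorphM.
have NN : vsim m (val c) (jK (galNorm 1 {:K} ((q`_i)%:A * z ^+ i))).
  rewrite -jA -Nw /galNorm !rmorph_prod -[X in vsim m X _]big_filter.
  rewrite -[X in vsim m _ X]big_filter.
  by apply: vsim_prod => // s; rewrite mem_filter => /andP[sG _]; apply: sims.
pose v := val q`_i * (-1) ^+ i.
have Ne : jK (galNorm 1 {:K} ((q`_i)%:A * z ^+ i)) = (- x j0) ^+ i * v ^+ p.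
  rewrite galNormM galNormX Nz (galNorm_alg cK) rmorphM rmorphXn /= !jA.
  rewrite rmorphXn rmorphM rmorphXn !rmorphN1 rmorphN /= aE /v exprMn.
  by rewrite exprMn -!exprM (mulnC p i); ring.
rewrite Ne in NN; have v0 := vsim_neq0r NN.
have Hv : v \in H.
  by rewrite rpredM // ?rpredX ?rpredN ?rpred1 //; apply: FH; exact: sfvalP.
have [|u Hu eu] := max_unit_pow _ (vsim_div mP v0 NN).
  rewrite rpred_div //; first by apply: FH; exact: sfvalP.
  by rewrite rpredM ?rpredX // rpredN; exact: xH.
exists i, (v * u); split; first by rewrite rpredM.
by rewrite exprMn eu mulrA [RHS]mulrC divfK.
Qed.

End Norm.
End Core.

(** * Fields realizing the invariants *)

(* The classes of xi and of the x_j with j <> j0 span F^x/N(K^x), with no relation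
   except possibly one on xi, which is governed by Q; the classes of the t_i
   form a basis of N(K^x)/F^(x p).  The index j0 is kept apart because x_j0 is
   the element whose p-th root generates K in the ramified case. *)
Definition realized (p : nat) (E J : eqType) (j0 : J) (Q : nat -> Prop) :=
  exists (F : fieldType) (xi : F) (K : splittingFieldType F) (cK : cyclic_ext p K)
    (x : J -> F) (t : E -> F),
  [/\ p.-primitive_root xi, forall j, x j != 0, forall i, is_norm K (t i),
    forall (r : nat) s (n : J -> nat), uniq s -> j0 \notin s ->
      is_norm K (xi ^+ r * \prod_(j <- s) x j ^+ n j) ->
      (forall j, j \in s -> (p %| n j)%N) /\ Q r &
    [/\ forall n (s : 'I_n -> E) (k : 'I_n -> nat) (f : F), injective s ->
        \prod_(j < n) t (s j) ^+ k j = f ^+ p -> forall j, (p %| k j)%N,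
      forall c, c != 0 -> exists (k : nat) (s : seq J) (n : J -> nat) (r : seq (E * nat)) f,
        [/\ uniq s, j0 \notin s &
          c = xi ^+ k * \prod_(j <- s) x j ^+ n j * \prod_(q <- r) t q.1 ^+ q.2 * f ^+ p] &
      Q 1%N -> exists f, f ^+ p = xi]].

Lemma supp_nat (J : eqType) (s : seq J) (n : J -> nat) : uniq s ->
  supp (fun j => if j \in s then (n j)%:Z else 0) s.
Proof. by move=> us; split=> // j; case: ifP => // _; rewrite eqxx. Qed.

Lemma mon_nat (W : fieldType) (J : eqType) (x : J -> W) (s : seq J) (n : J -> nat) :
  mon x s (fun j => if j \in s then (n j)%:Z else 0) = \prod_(j <- s) x j ^+ n j.
Proof. by rewrite /mon big_seq [RHS]big_seq; apply: eq_bigr => j ->. Qed.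

Lemma sfield_neq0 (W : fieldType) (F : divringClosed W) (y : sfield F) :
  (val y != 0) = (y != 0).
Proof. by rewrite -(rmorph0 (val : sfield F -> W)) (inj_eq val_inj). Qed.

Section Ramified.
Variables (p : nat) (p_pr : prime p) (E J : eqType) (e0 : E) (j0 : J).
Variables (L1 : divringClosed algC) (xi1 : algC).
Hypotheses (xi1P : p.-primitive_root xi1) (L1xi : xi1 \in L1).
Hypothesis L1pow : forall z, z \in L1 -> z != 0 -> exists2 k, (k < p)%N &
  exists2 y, y \in L1 & z = xi1 ^+ k * y ^+ p.

Let p_gt0 : (0 < p)%N := prime_gt0 p_pr.

Lemma realized_ramified : realized p E j0 (fun r => exists2 y, y \in L1 & y ^+ p = xi1 ^+ r).
Proof.
have [W [io [m [L [x [c [[mP Lm x0 xm] [ioL cL c0 c_inj] [T1 T2 _]]]]]]]] :=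
  valued_field_ex E J L1.
pose xi := io xi1.
have xiP : p.-primitive_root xi by rewrite fmorph_primitive_root.
have Lxi : xi \in L by apply: ioL.
have Lpow := T1 p xi1 L1pow.
(* The variable x_j0 is left for the last step, so that it is transcendental over a field containing
   all the d_i. *)
have [k [Lk xk dk]] := monomial_field x0 mP Lm xm (fun j => j <> j0).
have [k1 k1P] := adjoin_ex k (x j0).
have nj0 : ~ j0 <> j0 by [].
have kk1 z : z \in k -> z \in k1 by move=> kz; apply/k1P/adjoins_base.
have dk1 : dominated m (monG x L (fun=> True)) k1.
  move=> h Hh h0; have [g Gg hg] := dominated_adjoin x0 mP Lm xm dk nj0 k1P Hh h0.
  by exists g => //; apply: monGS Gg.
have [H [k1H domH maxH]] := dominated_maximal dk1.
have xk1 j : x j \in k1.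
  have [->|/eqP jj0] := eqVneq j j0; first exact/k1P/adjoins_gen.
  by apply: kk1; apply: xk.
have LH : {subset L <= H} by move=> l /Lk /kk1 /k1H.
have xH j : True -> x j \in H by move=> _; apply: k1H.
(* The value 0 at e0 makes -x_j0 itself one of the T_i, so E indexes the classes of norms
   exactly. *)
pose c1 i := if i == e0 then 0 else c i.
pose d i := c1 i ^+ p.
pose T i := d i - x j0.
have c1L i : c1 i \in L by rewrite /c1; case: ifP => _ //; rewrite rpred0.
have d_inj : injective d.
  move=> i i'; rewrite /d /c1; case: eqP => [->|_]; case: eqP => [->|_] //.
  - by move=> /esym/eqP; rewrite expr0n gtn_eqF //= expf_eq0 (negPf (c0 _)) andbF.
  - by move=> /eqP; rewrite expr0n gtn_eqF //= expf_eq0 (negPf (c0 _)) andbF.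
  - exact: c_inj.
have kd i : d i \in k by rewrite rpredX //; apply: Lk.
have tr (f : {poly W}) : f \is a polyOver k -> f != 0 -> f.[x j0] != 0.
  exact: (monG_transc x0 mP Lm xm dk nj0).
have Tind := pindep_linear p_gt0 tr k1P kd d_inj.
have Tn0 i : T i != 0.
  have := tr ((d i)%:P - 'X); rewrite !hornerE; apply.
    by rewrite rpredB ?polyOverC ?polyOverX.
  by rewrite -opprB oppr_eq0 polyXsubC_eq0.
have Tk1 i : T i \in k1 by rewrite rpredB //; apply: kk1.
have [F [k1F FH FT Fspan]] := Kummer_Zorn p_pr xiP (kk1 _ (Lk _ Lxi)) Tk1 Tn0 k1H Tind.
have Fxi : xi \in F by apply/k1F/kk1/Lk.
have Fx j : x j \in F by apply: k1F.
have FL l : l \in L -> l \in F by move=> /Lk /kk1 /k1F.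
pose iota : {rmorphism sfield F -> W} := (val : sfield F -> W).
pose xiF : sfield F := SField Fxi; pose a : sfield F := SField (Fx j0).
have xiFP : p.-primitive_root xiF by rewrite -(fmorph_primitive_root iota).
have [alpha alphaP] := closed_root (x j0) p_gt0.
have a_npow (y : sfield F) : y ^+ p <> a.
  move=> e; have Hy : val y \in H by apply/FH/sfvalP.
  have [|dn _] := max_indep mP Lm x0 xm p_pr domH (rpred1 L) (oner_neq0 W) (supp_unitv j0) Hy.
  - by rewrite mon_unitv mul1r -[x j0]/(val a) -e rmorphXn.
  have := dn j0; rewrite /unitv eqxx dvdzE /= dvdn1 => /eqP p1.
  by move: p_pr; rewrite p1.
have [K [z [jK [cK zp jz jA zE]]]] := Kummer_ext p_pr xiFP a_npow (iota := iota) alphaP.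
have a0 : a != 0 by rewrite -sfield_neq0; exact: x0.
have z_inj : {in 'Gal({:K} / 1)%g &, injective (fun s : gal_of {:K} => s z)}.
  by apply: (gal_inj (z := z)) => // w'; have [q' [_ ->]] := zE w'; exists q'.
have FT' i : T i \in F by apply: k1F.
exists (sfield F), xiF, K, cK, (fun j => SField (Fx j)), (fun i => SField (FT' i)).
split=> //.
- move=> i; have Ni := galNorm_sub p_pr cK zp (SField (FL _ (c1L i))) z_inj.
  have eN : SField (FL _ (c1L i)) ^+ p - a = SField (FT' i).
    by apply: val_inj; rewrite rmorphB rmorphXn.
  rewrite eN in Ni; exists ((SField (FL _ (c1L i)))%:A - z) => //.
  rewrite -(galNorm_eq0 1 {:K}) Ni -in_algE fmorph_eq0.
  by rewrite -sfield_neq0; exact: Tn0.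
- move=> r s n us j0s [w w0 Nw].
  have [i [u [Hu e]]] := norm_max mP Lm x0 xm p_pr xiP Lxi LH xH domH maxH FH cK zp jz jA zE
     (erefl : val xiF = xi) (erefl : val a = x j0) alphaP I w0 Nw.
  have [||dn [y Ly ey]] := max_indep_norm mP Lm x0 xm p_pr xiP Lxi domH (r := r) (i := i)
      (supp_nat n us) _ Hu (j0 := j0).
  + by rewrite (negPf j0s).
  + by rewrite mon_nat -e rmorphM rmorphXn rmorph_prod; under [in RHS]eq_bigr do rewrite rmorphXn.
  split=> [j js|]; first by have := dn j; rewrite js.
  by apply: (T2 _ _ y) => //; rewrite rmorphXn.
split.
- move=> n s q f inj_s e.
  apply: (FT n s q (val f) inj_s (sfvalP f)).
  have := congr1 val e; rewrite rmorph_prod rmorphXn => <-.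
  by apply: eq_bigr => j _; rewrite rmorphXn.
- move=> b b0; have Hb : val b \in H by apply/FH/sfvalP.
  have vb0 : val b != 0 by rewrite sfield_neq0.
  have [q [s [n [n0 [u [us j0s _ [Hu _] e]]]]]] :=
    max_decomp_nat mP Lm x0 p_pr xiP Lxi Lpow LH xH domH maxH j0 Hb vb0.
  set M := xi ^+ q * \prod_(j <- s) x j ^+ n j * (- x j0) ^+ n0 in e.
  have M0 : M != 0 by apply: contraNneq vb0 => M0; rewrite e M0 mul0r.
  have FM : M \in F.
    rewrite !rpredM ?rpredX ?rpredN // rpred_prod // => j _; exact: rpredX.
  (* The decomposition of b holds only in H; as M lies in F, so does u^p, and [Fspan] rewrites it
     with the T_i and a p-th power of F. *)
  have Fu : u ^+ p \in F.
    have -> : u ^+ p = val b / M by rewrite e mulrC mulKf.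
    by rewrite rpred_div // sfvalP.
  have [n' [s' [k' [f [_ Ff ef]]]]] := Fspan u Hu Fu.
  (* The head accounts for (-x_j0)^n0, since T_e0 = -x_j0. The index e0 may occur again in the tail,
     which a list of pairs allows. *)
  exists q, s, n, ((e0, n0) :: [seq (s' i, k' i) | i <- enum 'I_n']), (SField Ff).
  split=> //; apply: val_inj.
  rewrite big_cons big_map big_enum !rmorphM !rmorphXn !rmorph_prod /= e ef /M.
  have -> : T e0 = - x j0 by rewrite /T /d /c1 eqxx expr0n gtn_eqF // sub0r.
  have vX (y : sfield F) i : sfval (y ^+ i) = sfval y ^+ i.
    exact: (rmorphXn (val : sfield F -> W)).
  rewrite !mulrA; congr (_ * _ * _ * _ * _).
    by apply: eq_bigr => j _; rewrite vX.
  by apply: eq_bigr => j _; rewrite vX.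
- move=> [y Ly ey]; exists (SField (FL _ (ioL _ Ly))); apply: val_inj.
  by rewrite rmorphXn /= -rmorphXn ey expr1.
Qed.

End Ramified.

Section Real.
Variables (E J : eqType) (j0 : J) (L1 : divringClosed algC).
Hypothesis nE : E -> False.
Hypothesis L1pow : forall z, z \in L1 -> z != 0 -> exists2 k, (k < 2)%N &
  exists2 y, y \in L1 & z = (-1) ^+ k * y ^+ 2.
Hypothesis L1sq : forall z, z \in L1 -> exists2 y, y \in L1 & z ^+ 2 + 1 = y ^+ 2.
Hypothesis L1n : forall y, y \in L1 -> y ^+ 2 <> -1.

Lemma prim_root_N1 (R : numDomainType) : 2.-primitive_root (-1 : R).
Proof.
apply/andP; split=> //; apply/forallP => -[[|[|i]] ip] //=.
  rewrite unity_rootE expr1 eqbF_neg; apply/eqP => e.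
  have : (2%:R : R) == 0 by rewrite -[2%:R]/(1 + 1) -{1}e addNr.
  by rewrite pnatr_eq0.
by rewrite unity_rootE sqrrN expr1n !eqxx.
Qed.

(** Norms from H(sqrt(-1)) are sums of two squares. These are squares because each h^2 + 1 is a
    square in H, so no class of norms survives. *)
Lemma realized_real : realized 2 E j0 (fun r => exists2 y, y \in L1 & y ^+ 2 = (-1) ^+ r).
Proof.
have [W [io [m [L [x [c [[mP Lm x0 xm] [ioL _ _ _] [T1 T2 T3]]]]]]]] :=
  valued_field_ex E J L1.
pose xi := io (-1); have xiE : xi = -1 by rewrite /xi rmorphN1.
have xiP : 2.-primitive_root xi by rewrite fmorph_primitive_root; exact: prim_root_N1.
have Lxi : xi \in L by apply: ioL; rewrite rpredN rpred1.
have Lpow := T1 2%N (-1) L1pow.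
have Lsq := T3 L1sq.
have Ln l : l \in L -> l ^+ 2 + 1 != 0.
  move=> Ll; apply/eqP => /eqP; rewrite addr_eq0 -xiE => /eqP e.
  by have [y Ly] := T2 _ _ _ Ll e; apply: L1n.
pose A j := j <> j0; have nA : ~ A j0 by [].
have [k [Lk xk dk]] := monomial_field x0 mP Lm xm A.
have [H [kH domH maxH]] := dominated_maximal dk.
have LH : {subset L <= H} by move=> l /Lk /kH.
have xH j : A j -> x j \in H by move=> Aj; apply/kH/xk.
have p_pr : prime 2 by [].
have unit_sq h : h \in H -> vsim m h 1 -> exists2 u, u \in H & u ^+ 2 = h.
  exact: (max_unit_pow mP Lm x0 p_pr xiP Lxi LH domH maxH).
(* If the leading term of h involves some x_j, then 1 or h^2 dominates. Otherwise it is some l in L,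
   and l^2 + 1 is a nonzero square in L. In each case h^2 + 1 is a square times a 1-unit. *)
have sq h : h \in H -> exists2 u, u \in H & h ^+ 2 + 1 = u ^+ 2.
  move=> Hh; have Hh2 : h ^+ 2 + 1 \in H by rewrite rpredD ?rpredX ?rpred1.
  have conv u : u \in H -> u != 0 -> vsim m (h ^+ 2 + 1) (u ^+ 2) ->
      exists2 u, u \in H & h ^+ 2 + 1 = u ^+ 2.
    move=> Hu u0 s; have u2 : u ^+ 2 != 0 by rewrite expf_neq0.
    have [|v Hv ev] := unit_sq _ _ (vsim_div mP u2 s); first by rewrite rpred_div ?rpredX.
    by exists (v * u); rewrite ?rpredM // exprMn ev divfK.
  have [h0|h0] := eqVneq h 0; first by exists 1; rewrite ?rpred1 // h0 expr0n expr1n add0r.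
  have [_ [l [n [s [Ll l0 sn _ ->]]]] hl] := domH h Hh h0.
  have [[j nj]|n0] := pselect (exists j, n j != 0).
    have s0 : supp (fun=> 0 : int) ([::] : seq J) by split.
    have nj' : n j != (fun=> 0) j by [].
    have := mon_total x0 mP Lm xm Ll (rpred1 L) l0 (oner_neq0 W) sn s0 nj'.
    have -> : 1 * mon x [::] (fun=> 0) = 1 by rewrite /mon big_nil mulr1.
    case=> g1.
      have h1 : vlt m h 1 by apply: (vlt_siml mP hl).
      apply: (conv 1); rewrite ?rpred1 ?oner_neq0 // expr1n addrC; apply: vsim_addr.
      apply: (vlt_trans mP _ h1); rewrite expr2 -{3}[h]mulr1; exact: vltMl.
    have h1 : vlt m 1 h by apply: (vlt_simr mP g1); exact: vsim_sym.
    apply: (conv h) => //; apply: vsim_addr; apply: (vlt_trans mP h1).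
    by rewrite expr2 -{1}[h]mulr1; apply: vltMl.
  have e : mon x s n = 1.
    rewrite /mon big1 // => j _; have [->|nj] := eqVneq (n j) 0; first by rewrite expr0z.
    by case: n0; exists j.
  rewrite e mulr1 in hl; have [y Ly ey] := Lsq l Ll.
  have y20 : y ^+ 2 != 0 by rewrite -ey Ln.
  apply: (conv y); rewrite ?LH //; first by move: y20; rewrite expf_eq0.
  rewrite -ey /vsim.
  have -> : h ^+ 2 + 1 - (l ^+ 2 + 1) = h ^+ 2 - l ^+ 2 by ring.
  apply: (vlt_le_trans mP (vsimX mP 2 hl)) => -[l20]; apply: Lm.
    by rewrite rpred_div ?rpredD ?rpredX ?rpred1.
  by rewrite mulf_neq0 ?invr_eq0 ?Ln.
pose iota : {rmorphism sfield H -> W} := (val : sfield H -> W).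
have Hxi : xi \in H by apply: LH.
pose xiF : sfield H := SField Hxi.
have xiFP : 2.-primitive_root xiF by rewrite -(fmorph_primitive_root iota).
have [alpha alphaP] := @closed_root W 2 xi isT.
have a_npow (y : sfield H) : y ^+ 2 <> xiF.
  move=> e; have s0 : supp (fun=> 0 : int) ([::] : seq J) by split.
  have xi0 : xi != 0 by rewrite xiE oppr_eq0 oner_eq0.
  have [|_ [l Ll el]] := max_indep mP Lm x0 xm p_pr domH Lxi xi0 s0 (sfvalP y).
    by rewrite /mon big_nil mulr1 -[xi]/(val xiF) -e rmorphXn.
  by have := Ln l Ll; rewrite -el xiE addNr eqxx.
have [K [z [jK [cK zp jz jA zE]]]] := Kummer_ext p_pr xiFP a_npow (iota := iota) alphaP.
have z_inj : {in 'Gal({:K} / 1)%g &, injective (fun s : gal_of {:K} => s z)}.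
  by apply: (gal_inj (z := z)) => // w'; have [q' [_ ->]] := zE w'; exists q'.
have normH (b : sfield H) : is_norm K b -> exists2 u, u \in H & val b = u ^+ 2.
  move=> [w w0 Nw]; have [q [sq2 ew]] := zE w.
  rewrite (horner_coef_wide z (n := 2)) ?size_map_poly // in ew.
  rewrite !big_ord_recl big_ord0 addr0 /= !coef_map /= expr0 mulr1 expr1 in ew.
  have bE b' : b'%:A = b%:A :> K -> b' = b by move=> /(fmorph_inj (in_alg K)).
  have [q1|q1] := eqVneq q`_1 0.
    rewrite q1 scale0r mul0r addr0 in ew; rewrite ew (galNorm_alg cK) in Nw.
    exists (val q`_0); first exact: sfvalP.
    by rewrite -(bE _ Nw) rmorphXn.
  (* This shape lets [galNorm_sub] compute the norm as q_1^2 ((q_0 / q_1)^2 + 1). *)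
  have ew2 : w = (- q`_1)%:A * ((- (q`_0 / q`_1))%:A - z).
    rewrite ew mulrBr -!in_algE -rmorphM mulrNN (mulrC q`_1) divfK // rmorphN /=.
    by rewrite mulNr opprK.
  rewrite ew2 galNormM (galNorm_alg cK) (galNorm_sub p_pr cK zp _ z_inj) in Nw.
  rewrite -!in_algE -rmorphM in Nw; have {}Nw := bE _ Nw.
  have [u Hu eu] := sq (val (q`_0 / q`_1)) (sfvalP _).
  exists (val q`_1 * u); first by rewrite rpredM // sfvalP.
  rewrite -Nw rmorphM rmorphB !rmorphXn !rmorphN /= exprMn -eu !sqrrN.
  by rewrite xiE opprK.
(* The default 1 supplies a nonzero value at j0, an index that the products in [realized] avoid. *)
pose xF j : sfield H := insubd 1 (x j).
have xFE j : A j -> val (xF j) = x j by move=> /xH Hx; rewrite val_insubd Hx.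
have t0 : E -> sfield H by move=> e; case: (nE e).
exists (sfield H), xiF, K, cK, xF, t0; split=> //.
- move=> j; rewrite -sfield_neq0 val_insubd; case: ifP => _; first exact: x0.
  exact: oner_neq0.
- move=> r s n us j0s /normH[u Hu eu].
  have Lr : xi ^+ r \in L by rewrite rpredX.
  have r0 : xi ^+ r != 0 by rewrite expf_neq0 // xiE oppr_eq0 oner_eq0.
  have [|dn [y Ly ey]] := max_indep mP Lm x0 xm p_pr domH Lr r0 (supp_nat n us) Hu.
    rewrite mon_nat -eu rmorphM rmorphXn rmorph_prod; congr (_ * _).
    rewrite big_seq [RHS]big_seq; apply: eq_bigr => j js.
    have Aj : A j by move=> e; rewrite -e js in j0s.
    by rewrite -(xFE j Aj) rmorphXn.
  split=> [j js|]; first by have := dn j; rewrite js.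
  by apply: (T2 _ _ y) => //; rewrite rmorphXn.
split.
- by move=> n s q f _ _ j; case: (nE (s j)).
- move=> b b0; have vb0 : val b != 0 by rewrite sfield_neq0.
  have [q [s [n [n0 [u [us j0s As [Hu n00] e]]]]]] :=
    max_decomp_nat mP Lm x0 p_pr xiP Lxi Lpow LH xH domH maxH j0 (sfvalP b) vb0.
  exists q, s, n, [::], (SField Hu); split=> //; apply: val_inj.
  rewrite big_nil mulr1 !rmorphM !rmorphXn !rmorph_prod [LHS]e (n00 nA) expr0 mulr1.
  congr (_ * _ * _).
  rewrite big_seq [RHS]big_seq; apply: eq_bigr => j /As Aj.
  by rewrite -(xFE j Aj) rmorphXn.
- move=> [y Ly ey]; exists (SField (LH _ (ioL _ Ly))); apply: val_inj.
  by rewrite rmorphXn /= -rmorphXn ey expr1.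
Qed.

End Real.

(** * Choices of L1 among the algebraic numbers *)

Lemma full_subfield (W : fieldType) : exists F : divringClosed W, forall x, x \in F.
Proof. by have [//|//|//|F FP] := @mk_subfield W (fun=> True); exists F => x; apply/FP. Qed.

Lemma real_subfield : exists L1 : divringClosed algC,
  [/\ forall z, z \in L1 -> z != 0 -> exists2 k, (k < 2)%N &
        exists2 y, y \in L1 & z = (-1) ^+ k * y ^+ 2,
      forall z, z \in L1 -> exists2 y, y \in L1 & z ^+ 2 + 1 = y ^+ 2 &
      forall y, y \in L1 -> y ^+ 2 <> -1].
Proof.
have [|||L1 LP] := @mk_subfield algC (fun z => z \is Num.real).
- exact: rpred1.
- by move=> x y; exact: rpredB.
- by move=> x y; exact: rpred_div.
have sq z : 0 <= z -> sqrtC z \in L1.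
  by move=> z0; apply/LP; rewrite ger0_real // sqrtC_ge0.
exists L1; split.
- move=> z /LP zr z0; have [zp|zn] := real_ge0P zr.
    exists 0%N => //; exists (sqrtC z); first exact: sq.
    by rewrite sqrtCK mul1r.
  exists 1%N => //; exists (sqrtC (- z)); first by apply: sq; rewrite oppr_ge0 ltW.
  by rewrite sqrtCK expr1 mulN1r opprK.
- move=> z /LP zr; exists (sqrtC (z ^+ 2 + 1)); last by rewrite sqrtCK.
  by apply: sq; rewrite addr_ge0 ?ler01 // real_exprn_even_ge0.
- move=> y /LP yr e; have : 0 <= y ^+ 2 by rewrite real_exprn_even_ge0.
  by rewrite e oppr_ge0 ler10.
Qed.

Section NonPower.
Variables (p : nat) (p_pr : prime p) (xi : algC) (xiP : p.-primitive_root xi).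
Let p_gt0 : (0 < p)%N := prime_gt0 p_pr.

Lemma root_of_power (F : divringClosed algC) (y : algC) r : xi \in F -> y \in F ->
  y ^+ p = xi ^+ r -> ~~ (p %| r)%N -> exists2 g, g \in F & g ^+ p = xi.
Proof.
move=> Fxi Fy e pr; have r0 : (0 < r)%N by case: r pr {e}; rewrite ?dvdn0.
have [u v euv _] := egcdnP p r0; exists (y ^+ u); first exact: rpredX.
have cop : gcdn r p = 1%N.
  by apply/eqP; rewrite gcdnC -[_ == _]/(coprime p r) prime_coprime.
rewrite exprAC e -exprM mulnC euv cop exprD expr1 mulnC exprM.
by rewrite (prim_expr_order xiP) expr1n mul1r.
Qed.

(** The fixed field of a suitable automorphism contains xi but no p-th root of it. Enlarging it by
    [Kummer_Zorn] with the single element xi and H = algC, where everything is a p-th power, makes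
    xi generate all power classes. *)
Lemma nonpower_subfield : exists L1 : divringClosed algC, [/\ xi \in L1,
  forall z, z \in L1 -> z != 0 -> exists2 k, (k < p)%N &
    exists2 y, y \in L1 & z = xi ^+ k * y ^+ p &
  forall y r, y \in L1 -> y ^+ p = xi ^+ r -> (p %| r)%N].
Proof.
(* Raising p^2-th roots of unity to the power p + 1 fixes xi and multiplies any g with g^p = xi by
   xi, which is not 1. *)
have cop : coprime p.+1 (p ^ 2) by rewrite coprimeXr // coprimeSn.
have [u uP] := Qn_aut_exists cop.
have xi0 : xi != 0 by rewrite (prim_root_eq0 xiP) -lt0n.
have uxi : u xi = xi.
  by rewrite uP ?expnS ?expn1 ?exprM ?(prim_expr_order xiP) ?expr1n //
    exprS (prim_expr_order xiP) mulr1.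
have [|||F0 F0P] := @mk_subfield algC (fun z => u z = z).
- exact: rmorph1.
- by move=> x y ex ey; rewrite rmorphB ex ey.
- by move=> x y ex ey; rewrite fmorph_div ex ey.
have F0xi : xi \in F0 by apply/F0P.
have nroot g : g \in F0 -> g ^+ p <> xi.
  move=> /F0P ug e; move: ug; rewrite uP; last first.
    by rewrite expnS expn1 exprM e (prim_expr_order xiP).
  rewrite exprS e => /eqP; rewrite -subr_eq0 -{2}[g]mulr1 -mulrBr mulf_eq0.
  have g0 : g != 0 by apply: contraNneq xi0 => g0; rewrite -e g0 expr0n gtn_eqF.
  rewrite (negPf g0) /= subr_eq0 -[xi]expr1 -(prim_order_dvd xiP) dvdn1 => /eqP p1.
  by move: p_pr; rewrite p1.
have [H HP] := full_subfield algC.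
have ind0 : pindep p (fun _ : unit => xi) F0.
  move=> n s k f inj_s F0f e j; apply: contraT => pk.
  have [g F0g] : exists2 g, g \in F0 & g ^+ p = xi; last by move/(nroot g F0g).
  apply: (@root_of_power _ f (k j)) => //; rewrite -e (bigD1 j) //= big1 ?mulr1 // => i ij.
  by case/eqP: ij; apply: inj_s; case: (s i); case: (s j).
have F0H : {subset F0 <= H} by move=> x _; apply: HP.
have [L1 [F0L _ ind spn]] := Kummer_Zorn p_pr xiP F0xi (fun=> F0xi) (fun=> xi0) F0H ind0.
have L1xi := F0L _ F0xi.
exists L1; split=> //.
- move=> z Lz z0; have [y ey] := closed_root z p_gt0.
  have [|n [s [k [f [_ Lf e]]]]] := spn y (HP y); first by rewrite ey.
  exists ((\sum_(j < n) k j) %% p)%N; first by rewrite ltn_mod.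
  by exists f => //; rewrite -ey e (prim_expr_mod xiP) expr_sum.
- move=> y r Ly e; have s0 : injective (fun _ : 'I_1 => tt) by move=> i j _; rewrite !ord1.
  by have := ind 1%N (fun=> tt) (fun=> r) y s0 Ly; rewrite big_ord1 => /(_ (esym e) ord0).
Qed.

End NonPower.

(** * From power classes to bases *)

Lemma prod_family (F : fieldType) (J : eqType) (x : J -> F) n (s : 'I_n -> J)
    (k : 'I_n -> nat) : injective s -> exists n' : J -> nat,
  [/\ forall j, n' (s j) = k j, uniq [seq s j | j <- enum 'I_n] &
    \prod_(j < n) x (s j) ^+ k j = \prod_(i <- [seq s j | j <- enum 'I_n]) x i ^+ n' i].
Proof.
move=> inj_s; pose n' i := (\sum_(j < n | s j == i) k j)%N.
have n'E j : n' (s j) = k j.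
  by rewrite /n' (big_pred1 j) // => i /=; rewrite (inj_eq inj_s).
exists n'; split=> //; first by rewrite map_inj_uniq // enum_uniq.
by rewrite big_map big_enum; apply: eq_bigr => j _; rewrite n'E.
Qed.

Lemma seq_family (F : fieldType) (J : eqType) (x : J -> F) (s : seq J) (n : J -> nat) :
  uniq s -> exists N (t : 'I_N -> J) (k : 'I_N -> nat), injective t /\
  \prod_(i <- s) x i ^+ n i = \prod_(j < N) x (t j) ^+ k j.
Proof.
move=> us; exists (size s), (tnth (in_tuple s)), (fun j => n (tnth (in_tuple s) j)).
split; last by rewrite big_tnth.
by apply/tuple_uniqP.
Qed.

Lemma pair_family (F : fieldType) (E : Type) (t : E -> F) (r : seq (E * nat)) :
  exists N (s : 'I_N -> E) (k : 'I_N -> nat),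
  \prod_(q <- r) t q.1 ^+ q.2 = \prod_(j < N) t (s j) ^+ k j.
Proof.
exists (size r), (fun j => (tnth (in_tuple r) j).1), (fun j => (tnth (in_tuple r) j).2).
by rewrite big_tnth.
Qed.

Lemma UpsilonP (F : fieldType) (K : splittingFieldType F) (xi : F) :
  (is_norm K xi -> Upsilon K xi = 1%N) /\ (~ is_norm K xi -> Upsilon K xi = 0%N).
Proof. by rewrite /Upsilon; split=> h; [rewrite asboolT | rewrite asboolF]. Qed.

Section Conclude.
Variables (p : nat) (p_pr : prime p) (D E : eqType) (Q : nat -> Prop).

(** Here xi is a p-th power and gives no class, so an extra index [None] is reserved for the element
    adjoined and the x_d with d in D form the basis. *)
Lemma realized_option : realized p E (None : option D) Q -> Q 1%N ->
  exists (F : fieldType) (xi : F) (K : splittingFieldType F) (cK : cyclic_ext p K),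
     [/\ p.-primitive_root xi, has_dim (d_space p_pr cK) D,
         has_dim (e_space K p_pr) E & Upsilon K xi = 1%N].
Proof.
move=> [F [xi [K [cK [x [t [xiP x0 tN bind [tind spn root]]]]]]]] /root[g eg].
have xi0 : xi != 0 by rewrite (prim_root_eq0 xiP) -lt0n prime_gt0.
have g0 : g != 0 by apply: contraNneq xi0 => g0; rewrite -eg g0 expr0n gtn_eqF ?prime_gt0.
pose b (d : D) := x (Some d).
have b0 d : b d != 0 by exact: x0.
have b_ind n (s : 'I_n -> D) (k : 'I_n -> nat) : injective s ->
    is_norm K (\prod_(j < n) b (s j) ^+ k j) -> forall j, (p %| k j)%N.
  move=> inj_s; have inj_s' : injective (fun j => Some (s j)) by move=> i j [/inj_s].
  have [n' [n'E us e]] := prod_family x k inj_s'; rewrite e => N j.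
  have [||d _] := bind 0%N _ n' us.
  - by apply/mapP => -[].
  - by rewrite expr0 mul1r.
  by rewrite -n'E; apply: d; apply: map_f; rewrite mem_enum.
have bt_span c : c != 0 -> exists (n n' : nat) (s : 'I_n -> D) (k : 'I_n -> nat)
    (s' : 'I_n' -> E) (k' : 'I_n' -> nat) (f : F), injective s /\
    c = \prod_(j < n) b (s j) ^+ k j * \prod_(j < n') t (s' j) ^+ k' j * f ^+ p.
  move=> /spn[k [s [n [r [f [us Ns ->]]]]]].
  have [s1 es] : exists s1, s = map Some s1.
    elim: s Ns {us} => [|[d|] s IH] Ns; [by exists [::] | | by rewrite mem_head in Ns].
    have [|s1 ->] := IH; first by apply: contra Ns => h; rewrite in_cons h orbT.
    by exists (d :: s1).
  rewrite es map_inj_uniq in us; last by move=> ? ? [].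
  have [N [s2 [k2 [inj2 e2]]]] := seq_family b (fun d => n (Some d)) us.
  have [N' [s3 [k3 e3]]] := pair_family t r.
  exists N, N', s2, k2, s3, k3, (g ^+ k * f); split=> //.
  rewrite es big_map [X in _ * X * _ * _]e2 e3 exprMn exprAC eg.
  by rewrite [RHS]mulrA [in RHS](mulrC (_ * _) (xi ^+ k)) !mulrA.
exists F, xi, K, cK; split=> //.
- exact: (d_space_dim p_pr cK b0 tN b_ind bt_span).
- exact: (e_space_dim p_pr cK b0 tN b_ind tind bt_span).
- by apply: (proj1 (UpsilonP K xi)); rewrite -eg; exact: is_norm_pow.
Qed.

(** Here xi is not a norm and takes the place of x_d0 in the basis, which keeps the cardinality of
    D. *)
Lemma realized_pointed (d0 : D) : realized p E d0 Q -> (forall r, Q r -> (p %| r)%N) ->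
  exists (F : fieldType) (xi : F) (K : splittingFieldType F) (cK : cyclic_ext p K),
     [/\ p.-primitive_root xi, has_dim (d_space p_pr cK) D,
         has_dim (e_space K p_pr) E & Upsilon K xi = 0%N].
Proof.
move=> [F [xi [K [cK [x [t [xiP x0 tN bind [tind spn _]]]]]]]] Qp.
have xi0 : xi != 0 by rewrite (prim_root_eq0 xiP) -lt0n prime_gt0.
pose b (d : D) := if d == d0 then xi else x d.
have b0 d : b d != 0 by rewrite /b; case: ifP.
have b_ind n (s : 'I_n -> D) (k : 'I_n -> nat) : injective s ->
    is_norm K (\prod_(j < n) b (s j) ^+ k j) -> forall j, (p %| k j)%N.
  move=> inj_s; have [n' [n'E us e]] := prod_family b k inj_s; rewrite e => N j.
  set s1 := [seq s j | j <- enum 'I_n] in us N.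
  pose s2 := [seq d <- s1 | d != d0].
  pose r := if d0 \in s1 then n' d0 else 0%N.
  have [|||d Qr] := bind r s2 n'.
  - by rewrite filter_uniq.
  - by rewrite mem_filter eqxx.
  - move: N; rewrite (bigID (fun d => d == d0)) /=.
    have -> : \prod_(d <- s1 | d == d0) b d ^+ n' d = xi ^+ r.
      rewrite /r; case: ifP => h.
        by rewrite big_mkcond (bigD1_seq d0) //= eqxx /b eqxx big1 ?mulr1 // => d /negPf ->.
      by rewrite big_seq_cond big1 // => d /andP[ds /eqP e1]; rewrite -e1 ds in h.
    have -> // : \prod_(d <- s1 | d != d0) b d ^+ n' d = \prod_(d <- s2) x d ^+ n' d.
    by rewrite big_filter; apply: eq_bigr => d /negPf h; rewrite /b h.
  have sj : s j \in s1 by apply: map_f; rewrite mem_enum.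
  rewrite -n'E; have [e1|e1] := eqVneq (s j) d0.
    by have := Qp _ Qr; rewrite /r -e1 sj.
  by apply: d; rewrite mem_filter e1.
have bt_span c : c != 0 -> exists (n n' : nat) (s : 'I_n -> D) (k : 'I_n -> nat)
    (s' : 'I_n' -> E) (k' : 'I_n' -> nat) (f : F), injective s /\
    c = \prod_(j < n) b (s j) ^+ k j * \prod_(j < n') t (s' j) ^+ k' j * f ^+ p.
  move=> /spn[k [s [n [r [f [us Ns ->]]]]]].
  have us' : uniq (d0 :: s) by rewrite /= Ns us.
  have [N [s2 [k2 [inj2 e2]]]] := seq_family b (fun d => if d == d0 then k else n d) us'.
  have [N' [s3 [k3 e3]]] := pair_family t r.
  exists N, N', s2, k2, s3, k3, f; split=> //.
  rewrite -e2 e3 big_cons /b eqxx; congr (_ * _ * _ * _).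
  rewrite big_seq [RHS]big_seq; apply: eq_bigr => d ds.
  by case: eqP => // e1; rewrite -e1 ds in Ns.
exists F, xi, K, cK; split=> //.
- exact: (d_space_dim p_pr cK b0 tN b_ind bt_span).
- exact: (e_space_dim p_pr cK b0 tN b_ind tind bt_span).
- apply: (proj2 (UpsilonP K xi)) => N.
  have [//|//||_ Q1] := bind 1%N [::] (fun=> 0%N); first by rewrite big_nil expr1 mulr1.
  by have := Qp _ Q1; rewrite dvdn1 => /eqP p1; move: p_pr; rewrite p1.
Qed.

End Conclude.

(** * The equivalence *)

Local Open Scope classical_set_scope.
Local Open Scope card_scope.

Lemma card_ge1 (T : Type) : `I_1 #<= [set: T] <-> exists t : T, True.
Proof.
split=> [h|[t _]].
  apply: contrapT => n; have e : [set: T] = set0.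
    by apply/seteqP; split=> // t _; case: n; exists t.
  by move: h; rewrite e card_le0 => /eqP/seteqP[h _]; case: (h 0%N).
have h : [set t] #<= [set: T] by apply: subset_card_le.
by rewrite -(card_le_eql (card_set1 (x := t))).
Qed.

Theorem theorem1 (p : nat) (p_pr : prime p) (D E : Type) (Y : nat)
    (Y01 : Y = 0%N \/ Y = 1%N) :
  (exists (F : fieldType) (xi : F) (K : splittingFieldType F)
     (cK : cyclic_ext p K),
     [/\ p.-primitive_root xi, has_dim (d_space p_pr cK) D,
         has_dim (e_space K p_pr) E & Upsilon K xi = Y])
  <->
  [/\ Y = 0%N -> `I_1 #<= [set: D],
      (2 < p)%N -> `I_1 #<= [set: E] &
      p = 2%N /\ Y = 1%N -> `I_1 #<= [set: E]].
Proof.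
split.
  move=> [F [xi [K [cK [xiP dD dE eY]]]]].
  have xi0 : xi != 0 by rewrite (prim_root_eq0 xiP) -lt0n prime_gt0.
  have inh (T : Type) : ~ (T -> False) -> `I_1 #<= [set: T].
    by move=> h; apply/card_ge1; apply: contrapT => n; apply: h => t; apply: n; exists t.
  split.
  - move=> Y0; apply: inh => nD.
    by have := proj1 (UpsilonP K xi) (d_space_empty dD nD xi0); rewrite eY Y0.
  - move=> p2; apply: inh; apply: (e_space_inhabited cK xiP dE).
    have -> : -1 = (-1) ^+ p :> F.
      have [e|podd] := even_prime p_pr; first by rewrite e in p2.
      by rewrite -signr_odd podd.
    by apply: is_norm_pow; rewrite // oppr_eq0 oner_eq0.
  - move=> [p2 Y1]; apply: inh; apply: (e_space_inhabited cK xiP dE).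
    have xiN : xi = -1.
      have := prim_expr_order xiP; rewrite p2 => /eqP; rewrite sqrf_eq1 => /orP[|/eqP//].
      by rewrite -[xi]expr1 -(prim_order_dvd xiP) dvdn1 p2.
    apply: contrapT => n; rewrite -xiN in n.
    by have := proj2 (UpsilonP K xi) n; rewrite eY Y1.
move=> [hD hE hE2].
have [xi xiP] := C_prim_root_exists (prime_gt0 p_pr).
case: Y01 => eY; rewrite {}eY in hD hE2 *.
  have /card_ge1[d0 _] := hD (erefl _).
  have [[e0 _]|nE] := pselect (exists e : E, True).
    have [L1 [L1xi L1pow L1n]] := nonpower_subfield p_pr xiP.
    (* The [classic] aliases equip the arbitrary index types D and E with a decidable equality. *)
    apply: (@realized_pointed p p_pr {classic D} {classic E} _ d0
       (realized_ramified p_pr (e0 : {classic E}) (d0 : {classic D}) xiP L1xi L1pow)).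
    by move=> r [y Ly ey]; apply: L1n ey.
  (* An empty E excludes odd p by condition (2), which leaves the real construction. *)
  have p2 : p = 2%N.
    have := prime_gt1 p_pr; rewrite leq_eqVlt => /predU1P[//|/hE/card_ge1//].
  subst p; have [L1 [L1pow L1sq L1n]] := real_subfield.
  apply: (@realized_pointed 2 p_pr {classic D} {classic E} _ d0
     (realized_real (d0 : {classic D}) (fun e : {classic E} => nE (ex_intro _ e I)) L1pow L1sq L1n)).
  move=> r [y Ly ey]; rewrite dvdn2; apply/negP => ro; apply: (L1n y Ly).
  by rewrite ey -signr_odd ro.
have /card_ge1[e0 _] : `I_1 #<= [set: E].
  have := prime_gt1 p_pr; rewrite leq_eqVlt => /predU1P[e|]; last exact: hE.
  by apply: hE2.
(* For Upsilon = 1, all algebraic numbers are allowed, so that xi is a p-th power. *)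
have [L1 L1P] := full_subfield algC.
have L1pow z : z \in L1 -> z != 0 -> exists2 k, (k < p)%N &
    exists2 y, y \in L1 & z = xi ^+ k * y ^+ p.
  move=> _ _; exists 0%N; first exact: prime_gt0.
  by have [y ey] := closed_root z (prime_gt0 p_pr); exists y; rewrite ?mul1r.
apply: (@realized_option p p_pr {classic D} {classic E} _
   (realized_ramified p_pr (e0 : {classic E}) (None : option {classic D}) xiP (L1P xi) L1pow)).
by have [y ey] := closed_root xi (prime_gt0 p_pr); exists y.
Qed.
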